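(* Let a group $G$ act geometrically by automorphisms on a weakly systolic complex $X$. Then $G$ is Gromov hyperbolic if and only if there is no isometric embedding of the systolic plane in $X$.
   Context: Conventions: $X$ is connected; simplices are finite. A geometric action is properly discontinuous and cocompact. $d$ is the path metric of the $1$-skeleton on vertices; isometric embeddings are simplicial maps preserving this combinatorial distance between vertices. $X$ is flag if every finite set of pairwise adjacent vertices spans a simplex. The link $X_\sigma$ of a simplex $\sigma$ is the subcomplex of simplices $\tau$ disjoint from $\sigma$ with $\tau\cup\sigma$ spanning a simplex. $B_i(v)$ (resp. $S_i(v)$) is the full subcomplex spanned by vertices at distance at most $i$ (resp. exactly $i$) from $v$. Weakly systolic: $X$ is flag and for every vertex $v$ and every $i\ge1$: (E) for every edge $e\in S_{i+1}(v)$, $X_e\cap B_i(v)\ne\emptyset$; (V) for every vertex $w\in S_{i+1}(v)$, $X_w\cap B_i(v)$ is a single simplex. The systolic plane is the $2$-dimensional simplicial complex isomorphic to the triangulation of the Euclidean plane by equilateral triangles. *)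

(* Defs.v *)
From HB Require Import structures.
From mathcomp Require Import all_boot all_order all_algebra finmap.
From mathcomp Require Import boolp classical_sets cardinality.

Set Implicit Arguments.
Unset Strict Implicit.
Unset Printing Implicit Defensive.

Import Order.TTheory GRing.Theory Num.Theory.

Local Open Scope classical_set_scope.

(* ** Combinatorial distance in a graph *)

Definition walk (T : eqType) (e : rel T) (x y : T) (n : nat) : Prop :=
  exists p : seq T, [/\ path e x p, last x p = y & size p = n].

(* The value is 0 when y is not reachable from x; it is only meaningful on
   connected graphs. *)
Definition graph_dist (T : eqType) (e : rel T) (x y : T) : nat :=
  if pselect (exists n, `[< walk e x y n >]) is left ex_walk
  then ex_minn ex_walk else 0.

(* ** Simplicial complexes, with V as vertex set *)

Record simplicial_complex (V : choiceType) := SimplicialComplex {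
  simplices : set {fset V};
  simplex_neq0 : forall s, simplices s -> s <> fset0;
  simplex_vertex : forall v, simplices [fset v]%fset;
  simplex_face : forall s t,
    simplices s -> (t `<=` s)%fset -> t <> fset0 -> simplices t }.

Definition adj (V : choiceType) (X : simplicial_complex V) : rel V :=
  fun v w => (v != w) && `[< simplices X [fset v; w]%fset >].

Definition vdist (V : choiceType) (X : simplicial_complex V) : V -> V -> nat :=
  graph_dist (adj X).

(* The empty complex is not considered to be connected. *)
Definition connected_complex (V : choiceType) (X : simplicial_complex V) :
    Prop :=
  inhabited V /\ forall v w : V, exists n, walk (adj X) v w n.

Definition flag (V : choiceType) (X : simplicial_complex V) : Prop :=
  forall s : {fset V}, s <> fset0 ->
    (forall v w, v \in s -> w \in s -> v != w -> adj X v w) ->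
    simplices X s.

(* Subcomplexes are given by their sets of (nonempty) simplices. *)

Definition link (V : choiceType) (X : simplicial_complex V) (s : {fset V}) :
    set {fset V} :=
  [set t | [/\ simplices X t, [disjoint t & s]%fset
             & simplices X (t `|` s)%fset]].

Definition ball (V : choiceType) (X : simplicial_complex V) (v : V) (i : nat) :
    set {fset V} :=
  [set t | simplices X t /\ forall w, w \in t -> vdist X v w <= i].

Definition sphere (V : choiceType) (X : simplicial_complex V) (v : V)
    (i : nat) : set {fset V} :=
  [set t | simplices X t /\ forall w, w \in t -> vdist X v w = i].

Definition is_single_simplex (V : choiceType) (K : set {fset V}) : Prop :=
  exists s : {fset V}, s <> fset0 /\
    K = [set t | t <> fset0 /\ (t `<=` s)%fset].

Definition edge_condition (V : choiceType) (X : simplicial_complex V) (v : V)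
    (i : nat) : Prop :=
  forall e : {fset V}, sphere X v i.+1 e -> #|` e| = 2 ->
    link X e `&` ball X v i !=set0.

Definition vertex_condition (V : choiceType) (X : simplicial_complex V) (v : V)
    (i : nat) : Prop :=
  forall w : V, sphere X v i.+1 [fset w]%fset ->
    is_single_simplex (link X [fset w]%fset `&` ball X v i).

Definition weakly_systolic (V : choiceType) (X : simplicial_complex V) : Prop :=
  flag X /\
  forall (v : V) (i : nat), 1 <= i ->
    edge_condition X v i /\ vertex_condition X v i.

(* ** Geometric actions *)

Record simplicial_action (G : groupType) (V : choiceType)
    (X : simplicial_complex V) := SimplicialAction {
  act : G -> V -> V;
  act1 : forall v, act 1%g v = v;
  actM : forall g h v, act (g * h)%g v = act g (act h v);
  act_simplex : forall g (s : {fset V}),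
    simplices X [fset act g v | v in s]%fset <-> simplices X s }.

Definition translate (G : groupType) (V : choiceType)
    (X : simplicial_complex V) (A : simplicial_action G X) (g : G)
    (s : {fset V}) : {fset V} :=
  [fset act A g v | v in s]%fset.

Definition finite_subcomplex (V : choiceType) (X : simplicial_complex V)
    (K : set {fset V}) : Prop :=
  [/\ finite_set K, K `<=` simplices X
    & forall s t, K s -> (t `<=` s)%fset -> t <> fset0 -> K t].

(* A compact subset of the realization of X lies in a finite subcomplex, and
   two subcomplexes meet if and only if they have a common simplex. *)
Definition properly_discontinuous (G : groupType) (V : choiceType)
    (X : simplicial_complex V) (A : simplicial_action G X) : Prop :=
  forall K : set {fset V}, finite_subcomplex X K ->
    finite_set [set g : G | (translate A g @` K) `&` K !=set0].

Definition cocompact (G : groupType) (V : choiceType)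
    (X : simplicial_complex V) (A : simplicial_action G X) : Prop :=
  exists2 K : set {fset V}, finite_subcomplex X K &
    \bigcup_(g in [set: G]) (translate A g @` K) = simplices X.

Definition geometric_action (G : groupType) (V : choiceType)
    (X : simplicial_complex V) (A : simplicial_action G X) : Prop :=
  properly_discontinuous A /\ cocompact A.

(* ** Gromov hyperbolic groups *)

Definition gromov_product (T : Type) (d : T -> T -> nat) (w x y : T) : rat :=
  (((d x w)%:R + (d y w)%:R - (d x y)%:R) / 2%:R)%R.

Definition gromov_hyperbolic (T : Type) (d : T -> T -> nat) : Prop :=
  exists delta : rat, forall w x y z : T,
    (Num.min (gromov_product d w x y) (gromov_product d w y z) - delta
       <= gromov_product d w x z)%R.

Definition generates (G : groupType) (S : seq G) : Prop :=
  forall H : {pred G}, group_closed H -> {subset S <= H} ->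
    forall g : G, g \in H.

(* No generator is assumed to differ from 1 and S need not be symmetric. *)
Definition cayley_adj (G : groupType) (S : seq G) : rel G :=
  fun g h => (g != h) && ((g^-1 * h \in S) || (h^-1 * g \in S))%g.

Definition word_dist (G : groupType) (S : seq G) : G -> G -> nat :=
  graph_dist (cayley_adj S).

Definition hyperbolic_group (G : groupType) : Prop :=
  exists2 S : seq G, generates S & gromov_hyperbolic (word_dist S).

(* ** The systolic plane *)

(* (a, b) stands for the point a + b * exp(i pi / 3) of the triangular lattice;
   the triangles are the two halves of the unit rhombi of the lattice. *)
Definition up_triangle (p : int * int) : {fset int * int} :=
  [fset p; (p.1 + 1, p.2); (p.1, p.2 + 1)]%R%fset.

Definition down_triangle (p : int * int) : {fset int * int} :=
  [fset (p.1 + 1, p.2 + 1); (p.1 + 1, p.2); (p.1, p.2 + 1)]%R%fset.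

Definition plane_simplices : set {fset int * int} :=
  [set s | s <> fset0 /\
     exists p, (s `<=` up_triangle p)%fset \/ (s `<=` down_triangle p)%fset].

Lemma plane_simplex_neq0 s : plane_simplices s -> s <> fset0.
Proof. by case. Qed.

Lemma plane_simplex_vertex v : plane_simplices [fset v]%fset.
Proof.
split; first by move/fsetP/(_ v); rewrite !inE eqxx.
by exists v; left; rewrite fsub1set !inE eqxx.
Qed.

Lemma plane_simplex_face s t : plane_simplices s -> (t `<=` s)%fset ->
  t <> fset0 -> plane_simplices t.
Proof.
move=> [_ [p sp]] ts t0; split=> //; exists p.
by case: sp => sp; [left|right]; exact: fsubset_trans ts sp.
Qed.

Definition systolic_plane : simplicial_complex (int * int)%type :=
  SimplicialComplex plane_simplex_neq0 plane_simplex_vertex plane_simplex_face.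

Definition isometric_embedding (V W : choiceType) (Y : simplicial_complex V)
    (X : simplicial_complex W) (f : V -> W) : Prop :=
  (forall s, simplices Y s -> simplices X [fset f v | v in s]%fset) /\
  (forall v w, vdist X (f v) (f w) = vdist Y v w).

(* Main.v *)
Require Import Defs.
From mathcomp Require Import all_boot all_order all_algebra finmap.
From mathcomp Require Import boolp classical_sets cardinality filter.
From mathcomp Require Import zify lra.

Set Implicit Arguments.
Unset Strict Implicit.
Unset Printing Implicit Defensive.

Import Order.TTheory GRing.Theory Num.Theory.
Local Open Scope classical_set_scope.

(** Only the combinatorial distance d of X matters. The two local conditions
    on spheres say that the lower neighbours of a vertex form a clique and that
    two adjacent vertices of a sphere have a common lower neighbour; they give
    at once that balls are convex ([ball_convex]) and that, in a metric
    triangle u v w (one whose sides pairwise meet only at the corners), every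
    point of a side is equally far from the opposite corner
    ([metric_triangle_strongly_equilateral]).

    No plane implies hyperbolic. Descending from the side v w of a metric
    triangle towards u one sphere at a time, every layer is again a geodesic and
    spans a metric triangle with u, and the layers form an isometrically embedded
    flat equilateral triangle ([metric_triangle_deltoid]). If metric triangles
    had unbounded size, then translating the centres of larger and larger flat
    triangles into a fixed ball and passing to a limit along an ultrafilter
    would give an isometric plane ([deltoids_plane]). So they have size at most
    some mu. Then intervals are thin: two points p, q at the same height in the
    interval from x to y, at distance N, have quasi-medians with x and with y
    that lie near the middle of the interval from p to q but almost N apart,
    while convexity of balls bounds that distance by about N/2 ([geod_thin]).
    Thin intervals and bounded metric triangles make triangles of intervals slim
    ([geod_slim]). Transported by the action to a Cayley graph, the intervals
    form a family of connected sets with slim triangles, and the existence of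
    such a family forces hyperbolicity ([slim_family_four_point]).

    Hyperbolic implies no plane. In a hyperbolic space each point of a geodesic
    lies at distance O(log n) from every coarse path of n steps with the same
    ends ([four_point_near_geod]). An isometric plane in X gives a
    quasi-isometric copy of a sector of the plane in any Cayley graph of G; the
    two boundary paths between the acute corners of a rhombus of side R both have
    to pass within O(log R) of the middle of one geodesic, although they diverge
    linearly ([four_point_no_grid]). *)

(** * Graph metrics, intervals and quasi-medians *)

Record graph_metric (T : Type) (d : T -> T -> nat) : Prop := GraphMetric {
  gm_eq0 : forall x y, d x y = 0 -> x = y;
  gm_refl : forall x, d x x = 0;
  gm_sym : forall x y, d x y = d y x;
  gm_tri : forall x y z, d x z <= d x y + d y z;
  gm_step : forall x y n, d x y = n.+1 -> exists2 z, d x z = 1 & d z y = n }.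

(** The trace on the distance of [edge_condition] and [vertex_condition], with
    the trivial sphere of radius 1 included. *)
Record weakly_systolic_metric (T : Type) (d : T -> T -> nat) : Prop :=
    WeaklySystolicMetric {
  ws_gm : graph_metric d;
  ws_edge : forall v a b k, d a b = 1 -> d v a = k.+1 -> d v b = k.+1 ->
    exists c, [/\ d a c = 1, d b c = 1 & d v c = k];
  ws_vertex : forall v w a b k, d v w = k.+1 -> d w a = 1 -> d w b = 1 ->
    d v a = k -> d v b = k -> d a b <= 1 }.

Section Interval.
Variables (T : Type) (d : T -> T -> nat).

Definition geod_interval (x y : T) : set T := [set z | d x z + d z y = d x y].

Definition metric_triangle (x y z : T) : Prop :=
  [/\ forall t, geod_interval x y t -> geod_interval x z t -> t = x,
      forall t, geod_interval y x t -> geod_interval y z t -> t = y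
    & forall t, geod_interval z x t -> geod_interval z y t -> t = z].

Hypothesis gm : graph_metric d.
Let dC := gm_sym gm.
Let dT := gm_tri gm.

Lemma geod_point x y i : i <= d x y ->
  exists2 z, geod_interval x y z & d x z = i.
Proof.
elim: i => [|i IH] le_i.
  by exists x; rewrite /geod_interval /= ?(gm_refl gm).
have [z zI zi] := IH (ltnW le_i).
have [|z' zz' z'y] := @gm_step _ _ gm z y (d x y - i).-1.
  by rewrite /geod_interval /= in zI; lia.
rewrite /geod_interval /= in zI *.
have h1 := dT x z z'; have h2 := dT x z' y.
by exists z'; lia.
Qed.

Lemma geod_sym x y z : geod_interval x y z -> geod_interval y x z.
Proof. by rewrite /geod_interval /= addnC (dC x z) (dC z y) (dC x y). Qed.

Lemma geod_l x y : geod_interval x y x.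
Proof. by rewrite /geod_interval /= (gm_refl gm). Qed.

Lemma geod_r x y : geod_interval x y y.
Proof. by rewrite /geod_interval /= (gm_refl gm) addn0. Qed.

Lemma ex_farthest (P : T -> Prop) x n : (exists y, P y) ->
  (forall y, P y -> d x y <= n) ->
  exists2 y, P y & forall z, P z -> d x z <= d x y.
Proof.
move=> [y0 Py0] le_n.
have exP : exists i, `[< exists2 y, P y & d x y = i >].
  by exists (d x y0); apply/asboolP; exists y0.
have [|i /asboolP [y Py yi] max_i] := ex_maxnP exP (m := n).
  by move=> i /asboolP [y Py <-]; exact: le_n.
exists y => // z Pz; rewrite yi; apply: max_i; apply/asboolP; by exists z.
Qed.

(** Push each corner as far as possible along both of its sides, one corner
    after the other: maximality makes the remaining triangle a metric one. *)
Lemma ex_quasi_median x y z : exists x' y' z',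
  [/\ metric_triangle x' y' z',
      [/\ d x y = d x x' + d x' y' + d y' y,
          d x z = d x x' + d x' z' + d z' z
        & d y z = d y y' + d y' z' + d z' z],
      [/\ geod_interval x y x', geod_interval x y y' & d x y' = d x x' + d x' y'],
      [/\ geod_interval x z x', geod_interval x z z' & d x z' = d x x' + d x' z']
    & [/\ geod_interval y z y', geod_interval y z z' & d y z' = d y y' + d y' z']].
Proof.
have [x' [x'1 x'2] x'M] : exists2 x', geod_interval x y x' /\ geod_interval x z x' &
    forall t, geod_interval x y t /\ geod_interval x z t -> d x t <= d x x'.
  apply: (@ex_farthest _ _ (d x y)); first by exists x; split; exact: geod_l.
  by rewrite /geod_interval /=; lia.
have [y' [y'1 y'2] y'M] : exists2 y', geod_interval y x' y' /\ geod_interval y z y' &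
    forall t, geod_interval y x' t /\ geod_interval y z t -> d y t <= d y y'.
  apply: (@ex_farthest _ _ (d y x')); first by exists y; split; exact: geod_l.
  by rewrite /geod_interval /=; lia.
have [z' [z'1 z'2] z'M] : exists2 z', geod_interval z x' z' /\ geod_interval z y' z' &
    forall t, geod_interval z x' t /\ geod_interval z y' t -> d z t <= d z z'.
  apply: (@ex_farthest _ _ (d z x')); first by exists z; split; exact: geod_l.
  by rewrite /geod_interval /=; lia.
exists x', y', z'.
rewrite /metric_triangle /geod_interval /= in x'1 x'2 x'M y'1 y'2 y'M z'1 z'2 z'M *.
have sxx := dC x' x; have sx'y := dC x' y; have sy'y := dC y' y.
have sx'y' := dC x' y'; have sz'z := dC z' z; have sz'x' := dC z' x'.
have sz'y' := dC z' y'; have szx' := dC z x'; have szy' := dC z y'.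
have t1 := dT x x' y'; have t2 := dT x y' y; have t3 := dT x x' z'.
have t4 := dT x z' z; have t5 := dT y y' z'; have t6 := dT y z' z.
split; [split|split; lia|split; lia|split; lia|split; lia] => t h1 h2.
- apply/esym/(gm_eq0 gm); have /(_ _) := x'M t.
  have := dT x x' t; have := dT x t y; have := dT x t z.
  have := dT t y' y; have := dT t z' z; lia.
- apply/esym/(gm_eq0 gm); have /(_ _) := y'M t.
  have := dT y y' t; have := dT y t x'; have := dT y t z.
  have := dT t z' z; lia.
- apply/esym/(gm_eq0 gm); have /(_ _) := z'M t.
  have := dT z z' t; have := dT z t x'; have := dT z t y'; lia.
Qed.

End Interval.

(** * Convexity of balls and metric triangles in weakly systolic graphs *)

Section WeaklySystolic.
Variables (T : Type) (d : T -> T -> nat).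
Hypothesis ws : weakly_systolic_metric d.
Let gm := ws_gm ws.
Let dC := gm_sym gm.
Let dT := gm_tri gm.
Let d0 := gm_refl gm.

(** Convexity of balls comes from this one-sided form. Let x, p, p2 start the
    geodesic. If p2 came back to the level of x, then x and p2 would be lower
    neighbours of p, hence adjacent. If p2 stays at the level of p, a common
    lower neighbour c of p and p2 is adjacent to x, so the geodesic can be
    rerouted through x, c, p2 and induction applies. *)
Lemma geodesic_keeps_leaving_ball v x p y k :
  d v x = k -> d v p = k.+1 -> d x p = 1 -> d x p + d p y = d x y -> k < d v y.
Proof.
move en : (d p y) => n.
elim: n v x p y k en => [|n IH] v x p y k en vx vp xp xpy.
  by rewrite -(gm_eq0 gm en); lia.
have [p2 pp2 p2y] := gm_step gm en.
have t1 := dT x p p2; have t2 := dT x p2 y; have t3 := dT v p p2.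
have t4 := dT v p2 p; rewrite (dC p2 p) in t4.
have [lt1|[lvl|lvl]] : d v p2 < k.+1 \/ d v p2 = k.+1 \/ d v p2 = k.+2 by lia.
- have px : d p x = 1 by rewrite dC.
  have := ws_vertex ws vp px pp2 vx; lia.
- have [c [pc p2c vc]] := ws_edge ws pp2 vp lvl.
  have px : d p x = 1 by rewrite dC.
  have xc := ws_vertex ws vp px pc vx vc.
  have cp2 : d c p2 = 1 by rewrite dC.
  have t5 := dT x c y; have t6 := dT c p2 y.
  by apply: (IH v c p2 y k) => //; lia.
- have := IH v p p2 y k.+1 p2y vp lvl pp2; lia.
Qed.

Lemma exit_edge v x z y k : d v x <= k -> k < d v z -> geod_interval d x y z ->
  exists a b, [/\ d v a = k, d v b = k.+1, d a b = 1 & d a b + d b y = d a y].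
Proof.
rewrite /geod_interval /=.
move en : (d x z) => n; elim: n x en => [|n IH] x en vx vz xzy.
  have xz := gm_eq0 gm en; subst z; lia.
have [x1 xx1 x1z] := gm_step gm en.
have t1 := dT x x1 y; have t2 := dT x1 z y; have t3 := dT v x x1.
have [le_k|lt_k] := leqP (d v x1) k; first by apply: (IH x1) => //; lia.
by exists x, x1; split; lia.
Qed.

Lemma ball_convex v x y z :
  geod_interval d x y z -> d v z <= maxn (d v x) (d v y).
Proof.
move=> xyz; rewrite leqNgt; apply/negP => lt_z.
have vx : d v x <= maxn (d v x) (d v y) by rewrite leq_maxl.
have [a [b [va vb ab aby]]] := exit_edge vx lt_z xyz.
have := geodesic_keeps_leaving_ball va vb ab aby; lia.
Qed.

(** Each edge of the geodesic inside the sphere has a lower neighbour, the first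
    one being c. Consecutive ones are equal or adjacent, so none is closer to v
    than the start of its edge. The first point of the geodesic below the sphere
    would be equal or adjacent to the last of them, although it is two steps
    closer to v. A point above the sphere starts a geodesic that never returns. *)
Lemma sphere_geodesic u p p' c v z l :
  d u p = l.+1 -> d u p' = l.+1 -> d p p' = 1 -> d p p' + d p' v = d p v ->
  d p c = 1 -> d p' c = 1 -> d u c = l -> d p v <= d c v ->
  geod_interval d p' v z -> l < d u z.
Proof.
rewrite /geod_interval /=.
move en : (d p' v) => n.
elim: n p p' c en => [|n IH] p p' c en up up' pp' ppv pc p'c uc pv zI.
  have -> : z = p' by apply/(gm_eq0 gm); rewrite dC; lia.
  lia.
move ez : (d p' z) => m; case: m ez => [|m] ez.
  by rewrite -(gm_eq0 gm ez); lia.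
have [p2 p'p2 p2z] := gm_step gm ez.
have t1 := dT p' p2 v; have t2 := dT p2 z v.
have t3 := dT u p' p2; have t4 := dT u p2 p'; rewrite (dC p2 p') in t4.
have [lt1|[lvl|lvl]] : d u p2 = l \/ d u p2 = l.+1 \/ d u p2 = l.+2 by lia.
- have := ws_vertex ws up' p'c p'p2 uc lt1.
  have := dT c p2 v; lia.
- have [c' [p'c' p2c' uc']] := ws_edge ws p'p2 up' lvl.
  have := ws_vertex ws up' p'c p'c' uc uc'.
  have := dT c c' v => t5 t6.
  by apply: (IH p' p2 c') => //; lia.
- have := @geodesic_keeps_leaving_ball u p' p2 z l.+1 up' lvl p'p2; lia.
Qed.

Lemma metric_triangle_rot x y z :
  metric_triangle d x y z -> metric_triangle d y z x.
Proof. by case=> h1 h2 h3; split=> t a b; [exact: h2|exact: h3|exact: h1]. Qed.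

Lemma metric_triangle_swap x y z :
  metric_triangle d x y z -> metric_triangle d x z y.
Proof. by case=> h1 h2 h3; split=> t a b; [exact: h1|exact: h3|exact: h2]. Qed.

(** Starting from the farther corner w, the first edge towards v neither
    descends, as this would produce a point other than w on both sides at w,
    nor ascends, as it would then never return to the level of v. So it stays in
    the sphere, and [sphere_geodesic] applies. *)
Lemma opposite_side_far u v w z : metric_triangle d u v w ->
  d u v <= d u w -> geod_interval d w v z -> d u w <= d u z.
Proof.
move=> [_ _ mw] le_uvw zI.
move ez : (d w z) => m; case: m ez => [|m] ez.
  by rewrite (gm_eq0 gm ez).
case el : (d u w) => [|l] //.
have [w' ww' w'z] := gm_step gm ez.
rewrite /geod_interval /= in mw zI.
have t1 := dT w w' v; have t2 := dT w' z v.
have t3 := dT u w w'; have t4 := dT u w' w; rewrite (dC w' w) in t4.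
have [lvl|[lvl|lvl]] : d u w' = l \/ d u w' = l.+1 \/ d u w' = l.+2 by lia.
- have ww : w' = w by apply: mw; rewrite ?(dC w u) ?(dC w' u); lia.
  by rewrite ww d0 in ww'.
- have [c [wc w'c uc]] := ws_edge ws ww' el lvl.
  have cne : d c v <> (d w v).-1.
    move=> cv; have cw : c = w by apply: mw; rewrite ?(dC w u) ?(dC c u); lia.
    by rewrite cw d0 in wc.
  have t5 := dT w c v.
  by apply: (@sphere_geodesic u w w' c v z l) => //; rewrite /geod_interval /=; lia.
- have := @geodesic_keeps_leaving_ball u w w' v l.+1 el lvl ww'; lia.
Qed.

(** The opposite side is at least as far from u as the farther of its two ends
    and, by convexity of balls, at most as far. *)
Lemma metric_triangle_strongly_equilateral u v w z :
  metric_triangle d u v w -> geod_interval d v w z -> d u z = d u v.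
Proof.
move=> mt zI.
have le1 := ball_convex u zI.
have zI' := geod_sym gm zI.
have mt' := metric_triangle_swap mt.
case: (leqP (d u v) (d u w)) => [le|/ltnW le].
- have := opposite_side_far mt le zI'.
  have := opposite_side_far mt le (geod_r gm w v); lia.
- have := opposite_side_far mt' le zI; lia.
Qed.

Lemma metric_triangle_equilateral u v w : metric_triangle d u v w ->
  d u w = d u v /\ d v w = d u v.
Proof.
move=> mt.
have h1 := metric_triangle_strongly_equilateral mt (geod_r gm v w).
have h2 := metric_triangle_strongly_equilateral (metric_triangle_rot mt)
  (geod_r gm w u).
by rewrite h1 -h2 dC.
Qed.

End WeaklySystolic.

(** * Metric triangles span flat triangles *)

Definition geodesic (T : Type) (d : T -> T -> nat) (n : nat) (p : nat -> T) :=
  forall i j, i <= j -> j <= n -> d (p i) (p j) = j - i.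

Section Geodesics.
Variables (T : Type) (d : T -> T -> nat).
Hypothesis gm : graph_metric d.
Let dC := gm_sym gm.
Let dT := gm_tri gm.
Let d0 := gm_refl gm.

Lemma short_steps_le n (p : nat -> T) :
  (forall i, i < n -> d (p i) (p i.+1) <= 1) ->
  forall i j, i <= j -> j <= n -> d (p i) (p j) <= j - i.
Proof.
move=> step i j; elim: j => [|j IH] ij jn.
  by have -> : i = 0; [lia|rewrite d0].
have [->|ne] := eqVneq i j.+1; first by rewrite d0.
have := step j; have := dT (p i) (p j) (p j.+1); lia.
Qed.

Lemma short_steps_geodesic n (p : nat -> T) :
  (forall i, i < n -> d (p i) (p i.+1) <= 1) -> n <= d (p 0) (p n) ->
  geodesic d n p.
Proof.
move=> step far i j ij jn.
have h := short_steps_le step.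
have := h 0 i; have := h i j; have := h j n.
have := dT (p 0) (p i) (p n); have := dT (p i) (p j) (p n); lia.
Qed.

Lemma ex_geodesic x y :
  exists p, [/\ p 0 = x, p (d x y) = y & geodesic d (d x y) p].
Proof.
move en : (d x y) => n; elim: n x en => [|n IH] x en.
  exists (fun=> x); rewrite (gm_eq0 gm en); split=> // i j ij j0.
  by rewrite d0; lia.
have [z xz zy] := gm_step gm en.
have [p [p0 pn pg]] := IH z zy.
exists (fun i => if i is i'.+1 then p i' else x); split=> //.
apply: short_steps_geodesic => [[|i] lt_i|]; rewrite ?pn ?en ?p0 ?xz //.
by rewrite pg //; lia.
Qed.

End Geodesics.

(** The distance in the triangulated plane between the points with positions
    l, l' in the rows j, j' of a triangle whose row j has positions 0 to j: the
    three terms are the differences of the coordinates parallel to the three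
    sides. *)
Definition deltoid_dist (j l j' l' : nat) : nat :=
  maxn (maxn ((l - l') + (l' - l)) ((j - j') + (j' - j)))
       ((j - l - (j' - l')) + (j' - l' - (j - l))).

Lemma deltoid_dist_le k i j l D : i <= k.+1 -> l <= j -> j <= k ->
  k < j + D -> i <= l + D -> k.+1 + l <= j + i + D ->
  deltoid_dist k.+1 i j l <= D.
Proof.
rewrite /deltoid_dist !geq_max => *.
by apply/andP; split; [apply/andP; split|]; lia.
Qed.
(** A point i of row k+1 is adjacent to the points i and i-1 of row k, and one
    of the two starts a shortest way up. *)
Lemma deltoid_dist_ge k i j l D : i <= k.+1 -> l <= j -> j <= k ->
  (i <= k -> D <= (deltoid_dist k i j l).+1) ->
  (0 < i -> D <= (deltoid_dist k i.-1 j l).+1) -> D <= deltoid_dist k.+1 i j l.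
Proof.
move=> ik lj jk; have [il|il] := leqP i l.
  move=> h _.
  have {h} le_D : D <= (l - i + (k - j)).+1.
    apply: leq_trans (h _) _; first lia.
    rewrite /deltoid_dist ltnS !geq_max.
    by apply/andP; split; [apply/andP; split|]; lia.
  by rewrite /deltoid_dist leq_max; apply/orP; right; lia.
move=> _ h.
have {h} le_D : D <= (maxn (i - l.+1) (k - j)).+1.
  apply: leq_trans (h _) _; first lia.
  rewrite /deltoid_dist ltnS !geq_max.
  by apply/andP; split; [apply/andP; split|]; lia.
by rewrite /deltoid_dist leq_max; apply/orP; left; lia.
Qed.

Lemma deltoid_dist_apex j l : l <= j -> deltoid_dist 0 0 j l = j.
Proof. by rewrite /deltoid_dist; lia. Qed.

Lemma deltoid_dist_left j k : j <= k -> deltoid_dist j 0 k 0 = k - j.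
Proof. by rewrite /deltoid_dist; lia. Qed.

Lemma deltoid_dist_right j k : j <= k -> deltoid_dist j j k k = k - j.
Proof. by rewrite /deltoid_dist; lia. Qed.

Lemma deltoid_dist_row j l l' : l <= l' -> l' <= j ->
  deltoid_dist j l j l' = l' - l.
Proof. by rewrite /deltoid_dist; lia. Qed.

Lemma deltoid_dist_sym j l j' l' :
  deltoid_dist j l j' l' = deltoid_dist j' l' j l.
Proof.
by rewrite /deltoid_dist (addnC (l - l')) (addnC (j - j')) (addnC (_ - _ - _)).
Qed.

Definition deltoid (T : Type) (d : T -> T -> nat) (k : nat)
    (f : nat -> nat -> T) :=
  forall j l j' l', l <= j -> j <= k -> l' <= j' -> j' <= k ->
    d (f j l) (f j' l') = deltoid_dist j l j' l'.

Section Deltoid.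
Variables (T : Type) (d : T -> T -> nat).
Hypothesis ws : weakly_systolic_metric d.
Let gm := ws_gm ws.
Let dC := gm_sym gm.
Let dT := gm_tri gm.
Let d0 := gm_refl gm.

(** The quasi-median of u, v', w' has its first corner at u, because the sides
    u v' and u w' lie in sides of the given triangle. With m for its size,
    the distance of v' and w' is 2k - m; as it is at most k, we have m = k and
    the quasi-median is the triangle itself. *)
Lemma shrink_metric_triangle u v w k v' w' :
  metric_triangle d u v w -> d u v = k.+1 ->
  d u v' = k -> d v' v = 1 -> d u w' = k -> d w' w = 1 -> d v' w' <= k ->
  metric_triangle d u v' w' /\ d v' w' = k.
Proof.
move=> mt uv uv' v'v uw' w'w v'w'.
have [uw vw] := metric_triangle_equilateral ws mt.
have [u1 [v1 [w1 [mt1 [e1 e2 e3] [a1 a2 _] [b1 b2 _] _]]]] :=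
  ex_quasi_median gm u v' w'.
have [f1 f2] := metric_triangle_equilateral ws mt1.
rewrite /geod_interval /= in a1 a2 b1 b2.
have u1E : u1 = u.
  have [h _ _] := mt; apply: h; rewrite /geod_interval /=.
    by have := dT u u1 v; have := dT u1 v' v; lia.
  by have := dT u u1 w; have := dT u1 w' w; lia.
subst u1; rewrite d0 in e1 e2; have s := dC v' v1.
have v1E : v1 = v' by apply: (gm_eq0 gm); lia.
have w1E : w1 = w' by apply: (gm_eq0 gm); lia.
by subst v1 w1; split=> //; lia.
Qed.

(** Induction on the size. The lower neighbours q of the edges of p form a walk
    of length k, which is a geodesic and spans a metric triangle with u. The
    triangle built over q is extended by the row p: distances between p and
    the higher rows are bounded below by the distances to the corners u, v and
    w, which are known from strong equilaterality. The geodesic p is prescribed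
    so that the induction can impose q as the last row. *)
Lemma metric_triangle_deltoid k u v w p :
  metric_triangle d u v w -> d u v = k -> p 0 = v -> p k = w ->
  geodesic d k p ->
  exists f, [/\ f 0 0 = u, forall l, l <= k -> f k l = p l & deltoid d k f].
Proof.
elim: k u v w p => [|k IH] u v w p mt uv p0 pk pg.
  exists (fun _ _ => u); split=> //.
    by case=> // _; rewrite p0 (gm_eq0 gm uv).
  move=> j l j' l' lj j0 lj' j'0; rewrite d0 /deltoid_dist; lia.
have [uw vw] := metric_triangle_equilateral ws mt.
have up i : i <= k.+1 -> d u (p i) = k.+1.
  move=> ik; rewrite -uv.
  apply: (metric_triangle_strongly_equilateral ws mt).
  rewrite /geod_interval /= -p0 -pk !pg //; lia.
(* The next row: a common lower neighbour of each edge of p. *)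
have /choice [q qP] : forall i, exists c, i <= k ->
    [/\ d (p i) c = 1, d (p i.+1) c = 1 & d u c = k].
  move=> i; have [ik|] := boolP (i <= k); last by exists u.
  have pp : d (p i) (p i.+1) = 1 by rewrite pg; lia.
  by have [c c1] := ws_edge ws pp (up i (leqW ik)) (up i.+1 ik); exists c.
have qq i : i < k -> d (q i) (q i.+1) <= 1.
  move=> ik.
  have [|_ q1 q2] := qP i; first lia.
  have [|q3 _ q4] := qP i.+1; first lia.
  have ui : d u (p i.+1) = k.+1 by apply: up; lia.
  exact: (ws_vertex ws ui).
have [|q1 q2 q3] := qP 0; first lia.
have [|q4 q5 q6] := qP k; first lia.
have q0v : d (q 0) v = 1 by rewrite dC -p0.
have qkw : d (q k) w = 1 by rewrite dC -pk.
have q0k : d (q 0) (q k) <= k.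
  by have := short_steps_le gm qq (leq0n k) (leqnn k); lia.
have [mtq qk] := shrink_metric_triangle mt uv q3 q0v q6 qkw q0k.
have qg : geodesic d k q by apply: short_steps_geodesic => //; rewrite qk.
have [f [f0 fk fd]] := IH u (q 0) (q k) q mtq q3 erefl erefl qg.
have uf j l : l <= j -> j <= k -> d u (f j l) = j.
  by move=> lj jk; rewrite -f0 fd // deltoid_dist_apex.
have vf j : j <= k -> d v (f j j) = k.+1.
  move=> jk.
  have mtv : metric_triangle d v u w.
    by do 2![apply: metric_triangle_rot]; exact: metric_triangle_swap.
  rewrite -uv (dC u v); apply: (metric_triangle_strongly_equilateral ws mtv).
  have e1 := uf j j (leqnn j) jk.
  have e2 := fd j j k k (leqnn j) jk (leqnn k) (leqnn k).
  rewrite fk // deltoid_dist_right // in e2.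
  have := dT (f j j) (q k) w; have := dT u (f j j) w.
  rewrite qkw /geod_interval /=; lia.
have wf j : j <= k -> d w (f j 0) = k.+1.
  move=> jk.
  have mtw : metric_triangle d w u v by do 2![apply: metric_triangle_rot].
  rewrite -uv -uw (dC u w); apply: (metric_triangle_strongly_equilateral ws mtw).
  have e1 := uf j 0 (leq0n j) jk.
  have e2 := fd j 0 k 0 (leq0n j) jk (leq0n k) (leqnn k).
  rewrite fk // deltoid_dist_left // in e2.
  have := dT (f j 0) (q 0) v; have := dT u (f j 0) v.
  rewrite q0v /geod_interval /=; lia.
have pf i j l : i <= k.+1 -> l <= j -> j <= k ->
    d (p i) (f j l) = deltoid_dist k.+1 i j l.
  move=> ik lj jk.
  have up_i := up i ik; have ufjl := uf j l lj jk.
  have vp : d v (p i) = i by rewrite -p0 pg //; lia.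
  have wp : d w (p i) = k.+1 - i by rewrite -pk dC pg //; lia.
  have vfj := vf j jk; have wfj := wf j jk.
  have b1 := dT u (f j l) (p i); rewrite (dC (f j l)) in b1.
  have b2 := dT v (p i) (f j l); have b3 := dT v (f j l) (f j j).
  have b4 := dT w (p i) (f j l); have b5 := dT w (f j l) (f j 0).
  rewrite fd // deltoid_dist_row // in b3.
  rewrite fd // deltoid_dist_sym deltoid_dist_row // subn0 in b5.
  have upper1 : i <= k -> d (p i) (f j l) <= (deltoid_dist k i j l).+1.
    move=> ik'; have [|c1 _ _] := qP i; first lia.
    have := dT (p i) (q i) (f j l); rewrite c1 -fk // fd //; lia.
  have upper2 : 0 < i -> d (p i) (f j l) <= (deltoid_dist k i.-1 j l).+1.
    case: i ik {up_i vp wp b1 b2 b4 upper1} => // i ik _.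
    have [|_ c1 _] := qP i; first lia.
    have := dT (p i.+1) (q i) (f j l); rewrite c1 -fk // fd //; lia.
  apply/eqP; rewrite eqn_leq; apply/andP; split.
    exact: deltoid_dist_ge.
  by apply: deltoid_dist_le => //; lia.
exists (fun j l => if j <= k then f j l else p l); split=> //.
- by move=> l lk; rewrite ltnn.
move=> j l j' l' lj jk lj' jk'.
case: leqP => hj; case: leqP => hj'.
- exact: fd.
- have -> : j' = k.+1 by lia.
  by rewrite dC deltoid_dist_sym pf //; lia.
- have -> : j = k.+1 by lia.
  by rewrite pf //; lia.
have -> : j = k.+1 by lia.
have -> : j' = k.+1 by lia.
have [le|/ltnW le] := leqP l l'.
  by rewrite pg ?deltoid_dist_row //; lia.
by rewrite dC deltoid_dist_sym pg ?deltoid_dist_row //; lia.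
Qed.
End Deltoid.

(** * Thin intervals when metric triangles are bounded *)

Section ThinIntervals.
Variables (T : Type) (d : T -> T -> nat).
Hypothesis ws : weakly_systolic_metric d.
Let gm := ws_gm ws.
Let dC := gm_sym gm.
Let dT := gm_tri gm.

Variable mu : nat.
Hypothesis small_triangles :
  forall u v w, metric_triangle d u v w -> d u v <= mu.

(** The quasi-median (x1, p1, q1) of x, p, q and (y2, p2, q2) of y, p, q have
    sizes m, m' at most mu. As d x p = d x q, the points p1 and p2 are at
    distance (N - m)/2 and (N - m')/2 from p, where N = d p q. The way
    x, x1, p1, p2, y2, y is at least as long as d x y, which gives
    d p1 p2 >= N - (m + m')/2; and since p2 is between p and q, convexity of
    balls around p1 gives d p1 p2 <= (N + m)/2. *)
Lemma geod_thin x y p q : geod_interval d x y p -> geod_interval d x y q ->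
  d x p = d x q -> d p q <= 3 * mu.
Proof.
move=> pI qI xpq.
have [x1 [p1 [q1 [mt1 [e1 e2 e3] _ _ _]]]] := ex_quasi_median gm x p q.
have [y2 [p2 [q2 [mt2 [g1 g2 g3] _ _ [p2I _ _]]]]] := ex_quasi_median gm y p q.
have [f1 f2] := metric_triangle_equilateral ws mt1.
have [h1 h2] := metric_triangle_equilateral ws mt2.
have m1 := small_triangles mt1; have m2 := small_triangles mt2.
have cvx : d p1 p2 <= maxn (d p1 p) (d p1 q) := ball_convex ws p1 p2I.
have t1 := dT p1 q1 q.
have t2 := dT x x1 y; have t3 := dT x1 p1 y; have t4 := dT p1 p2 y.
have t5 := dT p2 y2 y.
have s1 := dC p p1; have s2 := dC p p2; have s3 := dC y y2.
have s4 := dC y2 p2; have s5 := dC p y; have s6 := dC q y.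
have s7 := dC q q1; have s8 := dC q q2.
rewrite /geod_interval /= in pI qI.
have [le|le] := leqP (d p1 p) (d p1 q).
  move/maxn_idPr: le cvx => ->; lia.
move/ltnW/maxn_idPl: le cvx => ->; lia.
Qed.

(** Compare p with the point at the same distance from x on the path through
    the two corners x1 and y1 of the quasi-median of x, y, z. That point is
    between x and z before x1, between z and y after y1, and within mu of x1 in
    the middle. *)
Lemma geod_slim x y z p : geod_interval d x y p ->
  exists2 q, geod_interval d x z q \/ geod_interval d z y q & d p q <= 4 * mu.
Proof.
move=> pI.
have [x1 [y1 [z1 [mt [e1 e2 e3] [a1 a2 _] [b1 _ _] [c1 _ _]]]]] :=
  ex_quasi_median gm x y z.
have m := small_triangles mt.
have thin := geod_thin pI.
have t1 := dT x y1 y; have t2 := dT x x1 y1.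
have [le1|lt1] := leqP (d x p) (d x x1).
  have [q qI eq] := geod_point gm le1.
  exists q.
    left; rewrite /geod_interval /= in b1 qI *.
    have := dT x q z; have := dT q x1 z; lia.
  have := thin q; rewrite /geod_interval /= in a1 qI *.
  have := dT x q y; have := dT q x1 y; lia.
have [le2|lt2] := leqP (d x p) (d x y1).
  have le2' : d x p - d x x1 <= d x1 y1 by lia.
  have [q qI eq] := geod_point gm le2'.
  exists x1; first by left.
  have := thin q; rewrite /geod_interval /= in a1 qI a2 *.
  have := dT p q x1; have := dC q x1; have := dT x x1 q; have := dT x q y.
  have := dT q y1 y; lia.
have le3 : d x p - d x y1 <= d y1 y by rewrite /geod_interval /= in pI a2; lia.
have [q qI eq] := geod_point gm le3.
exists q.
  right; rewrite /geod_interval /= in c1 qI *.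
  have := dT z q y; have := dT z y1 q; have := dC z y; have := dC y y1.
  have := dC y1 z; lia.
have := thin q; rewrite /geod_interval /= in a2 qI *.
have := dT x q y; have := dT x y1 q; lia.
Qed.

End ThinIntervals.

(** * Hyperbolicity of graph metrics *)

Lemma expn2_beats_linear A : exists m0, forall m, m0 <= m -> A * m.+1 <= 2 ^ m.
Proof.
exists (4 * A) => m le_m.
have -> : 2 ^ m = 2 ^ m./2 * 2 ^ (m - m./2) by rewrite -expnD subnKC //; lia.
have h1 := ltn_expl m./2 (isT : 1 < 2).
have h2 := ltn_expl (m - m./2) (isT : 1 < 2).
apply: leq_trans (leq_mul h1 h2); nia.
Qed.

(** The four point inequality for Gromov products, with every product replaced
    by its lower bounds t/2, which keeps it within the natural numbers. *)
Definition four_point (T : Type) (d : T -> T -> nat) (D : nat) :=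
  forall w x y z t, d x y + t <= d x w + d y w ->
    d y z + t <= d y w + d z w -> d x z + t <= d x w + d z w + D.

Lemma le_natD2 (a b m n : nat) : a + b <= m + n ->
  (a%:R + b%:R <= m%:R + n%:R :> rat)%R.
Proof. by rewrite -!natrD ler_nat. Qed.

Section FourPoint.
Variables (T : Type) (d : T -> T -> nat).
Hypothesis gm : graph_metric d.
Let dC := gm_sym gm.
Let dT := gm_tri gm.
Let d0 := gm_refl gm.

Lemma gromov_hyperbolicP :
  gromov_hyperbolic d <-> exists D, four_point d D.
Proof.
split=> [[delta hyp]|[D fp]].
  have [D le_D] : exists D : nat, (2%:R * delta <= D%:R)%R.
    exists (Num.bound `|2%:R * delta|%R).
    apply: le_trans (ler_norm _) _; apply: ltW.
    exact: archi_boundP (normr_ge0 _).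
  exists D => w x y z t h1 h2.
  have h1q := le_natD2 h1; have h2q := le_natD2 h2.
  rewrite -(ler_nat rat); move: (hyp w x y z).
  rewrite /gromov_product lerBlDr ge_min !natrD => /orP[|] h3; lra.
exists (D%:R / 2%:R)%R => w x y z.
have a1 := dT x w y; have a2 := dT y w z.
rewrite (dC w y) in a1; rewrite (dC w z) in a2.
have := fp w x y z (minn (d x w + d y w - d x y) (d y w + d z w - d y z)).
rewrite /gromov_product lerBlDr ge_min.
have [le|/ltnW le] := leqP (d x w + d y w - d x y) (d y w + d z w - d y z).
- move=> /(_ ltac:(lia) ltac:(lia)) h.
  have {}h : d x w + d y w + d x z <= d x w + d z w + (D + d x y) by lia.
  apply/orP; left; have := le_natD2 h; rewrite !natrD; lra.
- move=> /(_ ltac:(lia) ltac:(lia)) h.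
  have {}h : d y w + d z w + d x z <= d x w + d z w + (D + d y z) by lia.
  apply/orP; right; have := le_natD2 h; rewrite !natrD; lra.
Qed.

(** Bisecting the chain applies the four point inequality m times along each
    branch, so the loss is logarithmic in the length. *)
Lemma four_point_chain D : four_point d D ->
  forall m n a (s : nat -> T) w t, 0 < n -> n <= 2 ^ m ->
  (forall i, a <= i -> i < a + n ->
     d (s i) (s i.+1) + t <= d (s i) w + d (s i.+1) w) ->
  d (s a) (s (a + n)) + t <= d (s a) w + d (s (a + n)) w + m * D.
Proof.
move=> fp; elim=> [|m IH] n a s w t n0 nm step.
  have -> : n = 1 by rewrite expn0 in nm; lia.
  by rewrite addn1 mul0n addn0; apply: step; lia.
have tri := dT (s a) w (s (a + n)); rewrite (dC w) in tri.
have [n1|n1] := leqP n 1.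
  have nE : n = 1 by lia.
  have := step a (leqnn a); rewrite nE addn1; lia.
(* For small t the conclusion is weaker than the triangle inequality. *)
have [le_t|lt_t] := leqP t (m.+1 * D); first lia.
have h1 : d (s a) (s (a + n./2)) + t <=
    d (s a) w + d (s (a + n./2)) w + m * D.
  apply: IH => [||i ai ian]; [lia|rewrite expnS in nm; lia|apply: step; lia].
have h2 : d (s (a + n./2)) (s (a + n)) + t <=
    d (s (a + n./2)) w + d (s (a + n)) w + m * D.
  have -> : a + n = a + n./2 + (n - n./2) by lia.
  apply: IH => [||i ai ian]; [lia|rewrite expnS in nm; lia|apply: step; lia].
have := fp w (s a) (s (a + n./2)) (s (a + n)) (t - m * D).
rewrite mulSn in lt_t *; lia.
Qed.

End FourPoint.

(** The sets L x y stand for geodesics known up to bounded distance. Their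
    axioms are coarse, so they pass through quasi-isometries unchanged, unlike
    the four point inequality. *)
Section SlimFamily.
Variables (T : Type) (d : T -> T -> nat).
Hypothesis gm : graph_metric d.
Let dC := gm_sym gm.
Let dT := gm_tri gm.
Let d0 := gm_refl gm.
Variables (L : T -> T -> set T) (K : nat).
Hypothesis L_connected : forall x y, exists n (s : nat -> T),
  [/\ s 0 = x, s n = y, forall i, i <= n -> L x y (s i)
    & forall i, i < n -> d (s i) (s i.+1) <= K].
Hypothesis L_local : forall x y p, d x y <= 1 -> L x y p -> d x p <= K.
Hypothesis L_slim : forall x y z p, L x y p ->
  exists2 q, L x z q \/ L z y q & d p q <= K.

(** Bisect the path and use slimness at each of the m levels. *)
Lemma slim_family_log_close m n a (s : nat -> T) p : n <= 2 ^ m ->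
  (forall i, a <= i -> i < a + n -> d (s i) (s i.+1) <= 1) ->
  L (s a) (s (a + n)) p ->
  exists2 i, a <= i <= a + n & d p (s i) <= m.+1 * K.
Proof.
elim: m n a p => [|m IH] n a p nm step Lp.
  exists a; first by lia.
  rewrite dC mul1n; apply: L_local Lp; rewrite expn0 in nm.
  have [n0|n0] : n = 0 \/ n = 1 by lia.
    by rewrite n0 addn0 d0.
  by rewrite n0 addn1; apply: step; lia.
have [q [Lq|Lq] pq] := L_slim (s (a + n./2)) Lp.
  have [||i ai qi] := IH n./2 a q _ _ Lq; first by rewrite expnS in nm; lia.
    by move=> i ai ian; apply: step; lia.
  by exists i; [lia|have := dT p q (s i); rewrite (mulSn m.+1); lia].
have E : a + n = a + n./2 + (n - n./2) by lia.
rewrite E in Lq.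
have [||i ai qi] := IH _ _ q _ _ Lq; first by rewrite expnS in nm; lia.
  by move=> i ai ian; apply: step; lia.
by exists i; [lia|have := dT p q (s i); rewrite (mulSn m.+1); lia].
Qed.

(** Induction on the length of the geodesic s. Let s i0 be a point of s closest
    to p, at distance t, and cut s at distance 4t on either side of i0. By
    slimness p is near the set L of one of the three pieces. For an outer piece,
    unless it is reduced to an end of s, induction gives a point of it within
    B + 2K of p, so within t + B + 2K < 4t of s i0, if t > B. For the middle
    piece, of length at most 8t, the logarithmic bound gives
    t <= K (log (8t) + O(1)), impossible for large t. *)
Lemma slim_family_near_geodesic : exists B, forall n a (s : nat -> T) p,
  (forall i j, a <= i -> i <= j -> j <= a + n -> d (s i) (s j) = j - i) ->
  L (s a) (s (a + n)) p -> exists2 i, a <= i <= a + n & d p (s i) <= B.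
Proof.
(* If 8t <= 2^m < 16t and 48K(m+1) <= 2^m, then K(m+3) < t. *)
have [m0 m0P] := expn2_beats_linear (48 * K).
exists (3 * K + 2 ^ m0) => n.
elim/ltn_ind: n => n IH a s p sg Lp.
have exP : exists t, `[< exists2 i, a <= i <= a + n & d p (s i) = t >].
  by exists (d p (s a)); apply/asboolP; exists a => //; lia.
have [t /asboolP[i0 i0P pi0] t_min] := ex_minnP exP.
have {}t_min i : a <= i <= a + n -> t <= d p (s i).
  by move=> ai; apply: t_min; apply/asboolP; exists i.
exists i0 => //; rewrite pi0 leqNgt; apply/negP => t_big.
(* The cuts are truncated at the ends of s. *)
pose al := maxn a (i0 - 4 * t); pose be := minn (a + n) (i0 + 4 * t).
have al1 : a <= al by rewrite leq_maxl.
have al2 : al <= i0 by rewrite geq_max leq_subr andbT; case/andP: i0P.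
have be1 : be <= a + n by rewrite geq_minl.
have be2 : i0 <= be by rewrite leq_min leq_addr andbT; case/andP: i0P.
have [q [Lq|Lq] pq] := L_slim (s al) Lp.
  have [ala|ala] := leqP (i0 - 4 * t) a.
    have alE : al = a by apply/maxn_idPl.
    rewrite alE in Lq; have qa := L_local _ Lq; rewrite d0 in qa.
    have := t_min a; have := dT p q (s a); have := dC q (s a); lia.
  have alE : al = i0 - 4 * t by apply/maxn_idPr/ltnW.
  have E : al = a + (al - a) by lia.
  rewrite E in Lq.
  have [||j ja qj] := IH (al - a) _ a s q _ Lq.
  - by move: ala alE; lia.
  - by move=> i j ai ij ja; apply: sg => //; lia.
  have := dT p q (s j); have := sg j i0; have := dT (s j) p (s i0).
  rewrite (dC (s j) p) pi0; move: ala alE; lia.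
have [r [Lr|Lr] qr] := L_slim (s be) Lq.
  have exm : exists m, 8 * t <= 2 ^ m.
    by exists (8 * t); apply: ltnW; exact: ltn_expl.
  have [m tm m_min] := ex_minnP exm.
  have E : be = al + (be - al) by lia.
  have len : be - al <= 2 ^ m.
    have := leq_maxr a (i0 - 4 * t); have := geq_minr (a + n) (i0 + 4 * t).
    rewrite -/al -/be; lia.
  rewrite E in Lr.
  have [|j ja rj] := slim_family_log_close len _ Lr.
    by move=> i ai ian; rewrite sg //; lia.
  have m0m : m0 <= m.
    rewrite -(@leq_exp2l 2) //; lia.
  have lt_m : 2 ^ m < 16 * t.
    case: m m_min {tm len rj m0m} => [|m] m_min; first by rewrite expn0; lia.
    have := m_min m; rewrite expnS; lia.
  have := m0P m m0m; have := dT p q (s j); have := dT q r (s j).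
  have := t_min j; nia.
have [bea|bea] := leqP (a + n) (i0 + 4 * t).
  have beE : be = a + n by apply/minn_idPl.
  rewrite beE in Lr; have ra := L_local _ Lr; rewrite d0 in ra.
  have := t_min (a + n); have := dT p q (s (a + n)).
  have := dT q r (s (a + n)); have := dC r (s (a + n)); lia.
have beE : be = i0 + 4 * t by apply/minn_idPr/ltnW.
have E : a + n = be + (a + n - be) by lia.
rewrite E in Lr.
have [||j ja rj] := IH (a + n - be) _ be s r _ Lr.
- by move: bea beE; lia.
- by move=> i j ai ij ja; apply: sg => //; lia.
have := dT p q (s j); have := dT q r (s j); have := sg i0 j.
have := dT (s i0) p (s j); rewrite (dC (s i0) p) pi0; move: bea beE; lia.
Qed.

Lemma slim_family_near_interval : exists B, forall x y p,
  L x y p -> d x p + d p y <= d x y + B.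
Proof.
have [B BP] := slim_family_near_geodesic.
exists (2 * B) => x y p Lp.
have [s [s0 sn sg]] := ex_geodesic gm x y.
have [||i ix pi] := BP (d x y) 0 s p.
- by move=> i j _; exact: sg.
- by rewrite add0n s0 sn.
have := sg 0 i; have := sg i (d x y); rewrite s0 sn.
have := dT x (s i) p; have := dT p (s i) y; have := dC p (s i); lia.
Qed.

(** Up to constants, half of d x w + d w z - d x z is the distance from w to
    L x z. One inequality is the closeness of L x z to geodesics; for the other,
    L x z is coarsely connected and covered by neighbourhoods of L x w and
    L w z, so it has a point p close to both. Slimness then compares the
    distances of w to the three sides of x, y, z. *)
Lemma slim_family_four_point : exists D, four_point d D.
Proof.
have [B BP] := slim_family_near_interval.
exists (4 * B + 8 * K) => w x y z t h1 h2.
have [p Lp hp] : exists2 p, L x z p &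
    d x z + 2 * d p w <= d x w + d z w + (2 * B + 6 * K).
  have [n [s [s0 sn sL step]]] := L_connected x z.
  (* Either the end of s is close to L x w, or some point of s that is close to
     it is followed by one that is not, and then the latter is close to L w z. *)
  pose A i := `[< exists2 q, L x w q & d (s i) q <= K >].
  have [i iP [[q Lq iq] [r Lr ir]]] : exists2 i, i <= n &
      (exists2 q, L x w q & d (s i) q <= K) /\
      (exists2 r, L w z r & d (s i) r <= 2 * K).
    have A0 : A 0.
      have [n' [s' [s'0 _ s'L _]]] := L_connected x w.
      apply/asboolP; exists x; last by rewrite s0 d0.
      by rewrite -{2}s'0; exact: s'L.
    have [An|nAn] := boolP (A n).
      exists n => //; split; first exact/asboolP.
      have [n' [s' [_ s'n s'L _]]] := L_connected w z.
      exists z; last by rewrite sn d0.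
      by rewrite -{2}s'n; exact: s'L.
    have [i [i_n Ai nAi]] : exists i, [/\ i < n, A i & ~~ A i.+1].
      elim: (n) nAn {sn sL step} => [|k IH] nAk; first by rewrite A0 in nAk.
      have [Ak|nAk'] := boolP (A k); first by exists k.
      by have [i [ik ? ?]] := IH nAk'; exists i; split=> //; lia.
    exists i; first exact: ltnW.
    split; first exact/asboolP.
    have [r [Lr|Lr] ir] := L_slim w (sL i.+1 i_n).
      by case/negP: nAi; apply/asboolP; exists r.
    exists r => //; have := dT (s i) (s i.+1) r; have := step i i_n; lia.
  exists (s i); first exact: sL.
  have := BP _ _ _ Lq; have := BP _ _ _ Lr.
  have := dT x (s i) z; have := dT x q (s i); have := dT (s i) q w.
  have := dT w r (s i); have := dT (s i) r z; have := dC (s i) q.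
  have := dC (s i) r; have := dC w z; have := dC w (s i); lia.
have [q Lq pq] := L_slim y Lp.
have qw : t <= 2 * d q w + B.
  case: Lq => Lq; have := BP _ _ _ Lq.
  - have := dT x q w; have := dT y q w; have := dC y q; lia.
  - have := dT y q w; have := dT z q w; have := dC z q; lia.
have := dT q p w; have := dC q p; lia.
Qed.

End SlimFamily.

(** Here S is the logarithmic bound for a path of 2^(m+1) steps and E bounds the
    differences of coordinates of two points at distance at most 2S. *)
Lemma grid_side C D : exists m, let S := C + m.+1 * D in
  let E := C * (2 * S) + C in
  E + (C * (2 * (C * E + S) + 1) + C) < 2 ^ m.
Proof.
pose a := 4 * C * C * C + 4 * C; pose b := 2 * C * C * C + 3 * C.
have [m /(_ m (leqnn m)) mP] := expn2_beats_linear (b + a * C + a * D).+1.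
exists m => S E; apply: leq_trans mP; rewrite (mulSn _ m.+1) (addSn m) ltnS.
have -> : E + (C * (2 * (C * E + S) + 1) + C) = b + a * C + a * D * m.+1.
  by rewrite /E /S /a /b; clear; lia.
rewrite (mulnDl (b + _)) addnA leq_add2r; apply: leq_trans (leq_addl m _).
exact: leq_pmulr.
Qed.

Section NoPlane.
Variables (T : Type) (d : T -> T -> nat).
Hypothesis gm : graph_metric d.
Let dC := gm_sym gm.
Let dT := gm_tri gm.
Let d0 := gm_refl gm.

(** If the whole path stayed far from w, the chain inequality would give its
    ends a positive Gromov product at w, which is 0 as w is between them. *)
Lemma four_point_near_geod D m C (s : nat -> T) w : four_point d D ->
  geod_interval d (s 0) (s (2 ^ m)) w ->
  (forall i, i < 2 ^ m -> d (s i) (s i.+1) <= C) ->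
  exists2 i, i <= 2 ^ m & d (s i) w <= C + m * D.
Proof.
move=> fp wI step; apply: contrapT => no_i.
have far i : i <= 2 ^ m -> C + m * D < d (s i) w.
  by move=> im; rewrite ltnNge; apply/negP => le; apply: no_i; exists i.
have := @four_point_chain T d gm D fp m (2 ^ m) 0 s w (m * D).+1.
rewrite add0n expn_gt0 => /(_ isT (leqnn _)).
have h i : 0 <= i -> i < 2 ^ m ->
    d (s i) (s i.+1) + (m * D).+1 <= d (s i) w + d (s i.+1) w.
  by move=> _ im; have := far i; have := far i.+1; have := step i im; lia.
move/(_ h); rewrite /geod_interval /= in wI; have := dC w (s (2 ^ m)); lia.
Qed.

(** The paths s1 and s2 are the two boundary paths of the square of side R from
    (0, 0) to (R, R), and w is a midpoint of their ends. The points of s1 and s2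
    near w have almost equal coordinates, which forces them to be close to one
    of the two corners; but w is far from both. *)
Lemma four_point_no_grid D C (phi : nat -> nat -> T) : four_point d D ->
  (forall a b, d (phi a b) (phi a.+1 b) <= C) ->
  (forall a b, d (phi a b) (phi a b.+1) <= C) ->
  (forall a b a' b', a <= a' + C * d (phi a b) (phi a' b') + C) ->
  (forall a b a' b', b <= b' + C * d (phi a b) (phi a' b') + C) -> False.
Proof.
move=> fp stepa stepb lowa lowb.
have [m] := grid_side C D.
set S := C + m.+1 * D; set E := C * (2 * S) + C; set R := 2 ^ m => R_big.
pose x := phi 0 0; pose y := phi R R.
have [w wI xw] := @geod_point T d gm x y (d x y)./2 ltac:(lia).
have R2 : 2 ^ m.+1 = R + R by rewrite expnS mul2n addnn.
have xyR : R <= C * d x y + C by have := lowa R R 0 0; rewrite dC.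
pose s1 i := if i <= R then phi 0 i else phi (i - R) R.
pose s2 i := if i <= R then phi i 0 else phi R (i - R).
have s1x : s1 0 = x by [].
have s2x : s2 0 = x by [].
have RR : (R + R <= R) = false by have := expn_gt0 2 m; rewrite -/R; lia.
have s1y : s1 (2 ^ m.+1) = y by rewrite /s1 R2 RR addnK.
have s2y : s2 (2 ^ m.+1) = y by rewrite /s2 R2 RR addnK.
have [|i|i i_le iw] := @four_point_near_geod D m.+1 C s1 w fp.
- by rewrite s1x s1y.
- move=> _; rewrite /s1; have [iR|iR] := leqP i R; have [iR'|iR'] := leqP i.+1 R.
  + exact: stepb.
  + have -> : i = R by lia.
    by rewrite subSn // subnn; exact: stepa.
  + lia.
  + by rewrite subSn; [exact: stepa|lia].
have [|j|j j_le jw] := @four_point_near_geod D m.+1 C s2 w fp.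
- by rewrite s2x s2y.
- move=> _; rewrite /s2; have [iR|iR] := leqP j R; have [iR'|iR'] := leqP j.+1 R.
  + exact: stepa.
  + have -> : j = R by lia.
    by rewrite subSn // subnn; exact: stepb.
  + lia.
  + by rewrite subSn; [exact: stepb|lia].
have ij : C * d (s1 i) (s2 j) + C <= E.
  rewrite /E leq_add2r leq_mul2l; apply/orP; right.
  by have := dT (s1 i) w (s2 j); have := dC w (s2 j); rewrite -/S in iw jw; lia.
(* As w is halfway, the point s1 i near it is far from both corners. *)
have N_small : d (s1 i) x <= C * E \/ d (s1 i) y <= C * E -> False.
  move=> close.
  have le_N : d x y <= 2 * (C * E + S) + 1.
    case: close; have := dT x (s1 i) w; have := dT w (s1 i) y.
      have := dC x (s1 i); rewrite /geod_interval /= in wI; rewrite -/S in iw; lia.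
    have := dC w (s1 i); rewrite /geod_interval /= in wI; rewrite -/S in iw; lia.
  by have := leq_mul (leqnn C) le_N; lia.
have walkb b n a : d (phi a b) (phi a (b + n)) <= C * n.
  elim: n => [|n IH]; first by rewrite addn0 d0.
  have := dT (phi a b) (phi a (b + n)) (phi a (b + n.+1)).
  by have := stepb a (b + n); rewrite addnS mulnS; lia.
have walka a n b : d (phi a b) (phi (a + n) b) <= C * n.
  elim: n => [|n IH]; first by rewrite addn0 d0.
  have := dT (phi a b) (phi (a + n) b) (phi (a + n.+1) b).
  by have := stepa (a + n) b; rewrite addnS mulnS; lia.
rewrite R2 in i_le j_le.
move: ij N_small; rewrite /s1 /s2.
have [iR|iR] := leqP i R; have [jR|jR] := leqP j R => ij; apply.
- left; rewrite dC; apply: leq_trans (walkb 0 i 0) _.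
  by rewrite leq_mul2l; have := lowb 0 i j 0; lia.
- by have := lowa R (j - R) 0 i; rewrite (dC (phi R _)); lia.
- by have := lowb (i - R) R j 0; lia.
- right; have -> : y = phi (i - R + (R + R - i)) R by congr phi; lia.
  apply: leq_trans (walka _ _ _) _; rewrite leq_mul2l.
  by have := lowa R (j - R) (i - R) R; rewrite (dC (phi R _)); lia.
Qed.
End NoPlane.

(** * Graph distances and weakly systolic complexes *)

Section GraphDist.
Variables (T : eqType) (e : rel T).

Lemma walk_refl x : walk e x x 0.
Proof. by exists [::]. Qed.

Lemma walk1 x y : e x y -> walk e x y 1.
Proof. by move=> exy; exists [:: y]; rewrite /= exy. Qed.

Lemma walk_cat x y z m n : walk e x y m -> walk e y z n -> walk e x z (m + n).
Proof.
move=> [p [px py pm]] [q [qy qz qn]]; exists (p ++ q).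
by rewrite cat_path px py qy last_cat py qz size_cat pm qn.
Qed.

Lemma walk_sym x y n : symmetric e -> walk e x y n -> walk e y x n.
Proof.
move=> es [p [px py <-]]; elim: p x px py => [|z p IH] x /=.
  by move=> _ ->; exact: walk_refl.
move=> /andP[xz zp] py; rewrite -addn1; apply: (@walk_cat _ z); first exact: IH.
by apply: walk1; rewrite es.
Qed.

Lemma graph_dist_le x y n : walk e x y n -> graph_dist e x y <= n.
Proof.
move=> xy; rewrite /graph_dist; case: pselect => [ex|]; last first.
  by case; exists n; apply/asboolP.
by case: ex_minnP => m _; apply; apply/asboolP.
Qed.

Lemma graph_dist_walk x y n : walk e x y n -> walk e x y (graph_dist e x y).
Proof.
move=> xy; rewrite /graph_dist; case: pselect => [ex|]; last first.
  by case; exists n; apply/asboolP.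
by case: ex_minnP => m /asboolP.
Qed.

Hypothesis es : symmetric e.
Hypothesis ei : irreflexive e.
Hypothesis e_conn : forall x y, exists n, walk e x y n.

Let dist_walk x y : walk e x y (graph_dist e x y).
Proof. by have [n] := e_conn x y; exact: graph_dist_walk. Qed.

Lemma graph_dist_metric : graph_metric (graph_dist e).
Proof.
have eq0 x y : graph_dist e x y = 0 -> x = y.
  move=> xy0; have := dist_walk x y; rewrite xy0.
  by case=> -[|z p] [].
have tri x y z : graph_dist e x z <= graph_dist e x y + graph_dist e y z.
  by apply: graph_dist_le; apply: walk_cat; exact: dist_walk.
split=> //.
- by move=> x; apply/eqP; rewrite -leqn0; exact: graph_dist_le (walk_refl x).
- move=> x y; apply/eqP; rewrite eqn_leq.
  by rewrite !graph_dist_le //; apply: walk_sym => //; exact: dist_walk.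
- move=> x y n xyn; have := dist_walk x y; rewrite xyn.
  case=> -[|z p] [] //= /andP[xz zp] py [pn].
  have le1 : graph_dist e x z <= 1 by apply: graph_dist_le; exact: walk1.
  have len : graph_dist e z y <= n by apply: graph_dist_le; exists p.
  have := tri x z y => t; exists z; last lia.
  case E : (graph_dist e x z) => [|[|m]] //; last lia.
  by move: xz; rewrite (eq0 _ _ E) ei.
Qed.

Lemma graph_dist1 x y : graph_dist e x y = 1 <-> e x y.
Proof.
split=> [xy1|xy].
  have := dist_walk x y; rewrite xy1.
  by case=> -[|z [|? ?]] [] //=; rewrite andbT => xz <-.
have := graph_dist_le (walk1 xy); case E : (graph_dist e x y) => [|[|m]] // _.
by move: xy; rewrite (gm_eq0 graph_dist_metric E) ei.
Qed.

End GraphDist.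

Section Complex.
Variables (V : choiceType) (X : simplicial_complex V).

Lemma adj_sym : symmetric (adj X).
Proof. by move=> v w; rewrite /adj eq_sym fsetUC. Qed.

Lemma adj_irr : irreflexive (adj X).
Proof. by move=> v; rewrite /adj eqxx. Qed.

Hypothesis X_conn : connected_complex X.

Lemma vdist_metric : graph_metric (vdist X).
Proof. by case: X_conn => _ c; apply: graph_dist_metric adj_sym adj_irr c. Qed.

Lemma vdist1 v w : vdist X v w = 1 <-> adj X v w.
Proof. by case: X_conn => _ c; exact: graph_dist1 adj_sym adj_irr c v w. Qed.

Lemma simplex_edge (s : {fset V}) a b : simplices X s -> a \in s -> b \in s ->
  a != b -> vdist X a b = 1.
Proof.
move=> sX sa sb ab; apply/vdist1; rewrite /adj ab; apply/asboolP.
apply: simplex_face sX _ _; first by rewrite fsubUset !fsub1set sa.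
by move/fsetP/(_ a); rewrite !inE eqxx.
Qed.

(** In the sphere of radius 1 around v, which [edge_condition] and
    [vertex_condition] leave out, both properties hold since v is then the only
    lower neighbour. *)
Lemma weakly_systolic_vdist :
  weakly_systolic X -> weakly_systolic_metric (vdist X).
Proof.
move=> [_ ws]; have gm := vdist_metric; split=> //.
- move=> v a b [|k] ab va vb.
    have dC := gm_sym gm.
    by exists v; rewrite (dC a) (dC b) (gm_refl gm).
  have [/(_ [fset a; b]%fset) edge _] := ws v k.+1 isT.
  have /andP[neq_ab /asboolP abX] : adj X a b by apply/vdist1.
  case: edge; first by split=> // w; rewrite !inE => /orP[] /eqP ->.
    by rewrite cardfs2 neq_ab.
  move=> t [[tX tdis teX] [_ tball]].
  have [t0|[c ct]] := fset_0Vmem t; first by case: (simplex_neq0 tX).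
  have /fdisjointP/(_ c ct) := tdis; rewrite !inE negb_or => /andP[ca cb].
  have ac : vdist X a c = 1.
    by apply: simplex_edge teX _ _ _; rewrite ?inE ?eqxx ?ct ?orbT // eq_sym.
  have bc : vdist X b c = 1.
    by apply: simplex_edge teX _ _ _; rewrite ?inE ?eqxx ?ct ?orbT // eq_sym.
  exists c; split=> //.
  have := tball c ct; have := gm_tri gm v c a; rewrite (gm_sym gm c a); lia.
- move=> v w a b [|k] vw wa wb va vb.
    by rewrite -(gm_eq0 gm va) -(gm_eq0 gm vb) (gm_refl gm).
  have [_ /(_ w) vertex] := ws v k.+1 isT.
  case: vertex.
    by split=> [|x]; [exact: simplex_vertex|rewrite inE => /eqP ->].
  move=> s [s0 sE].
  have in_s c : vdist X w c = 1 -> vdist X v c = k.+1 -> c \in s.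
    move=> wc vc.
    have : (link X [fset w]%fset `&` ball X v k.+1) [fset c]%fset.
      have /andP[neq_wc /asboolP wcX] : adj X w c by apply/vdist1.
      split; split.
      + exact: simplex_vertex.
      + by rewrite fdisjoint1X inE eq_sym.
      + by rewrite fsetUC.
      + exact: simplex_vertex.
      + by move=> x; rewrite inE => /eqP ->; rewrite vc.
    by rewrite sE /= fsub1set => -[].
  have [->|neq_ab] := eqVneq a b; first by rewrite (gm_refl gm).
  have : (link X [fset w]%fset `&` ball X v k.+1) s by rewrite sE.
  by move=> [[sX _ _] _]; rewrite (simplex_edge sX) ?in_s.
Qed.

End Complex.

(** * Cayley graphs and geometric actions *)

Lemma finite_set_bounded (T : choiceType) (A : set T) (f : T -> nat) :
  finite_set A -> exists n, forall x, A x -> f x <= n.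
Proof.
case/finite_seqP => s ->; elim: s => [|x s [n IH]]; first by exists 0.
exists (maxn (f x) n) => y /=; rewrite inE leq_max => /predU1P[->|ys].
  by rewrite leqnn.
by rewrite IH ?orbT.
Qed.

Section CayleyGraph.
Variable G : groupType.
Implicit Types (S : seq G) (g h k : G).
Local Open Scope group_scope.

Lemma cayley_adj_sym S : symmetric (cayley_adj S).
Proof. by move=> g h; rewrite /cayley_adj eq_sym orbC. Qed.

Lemma cayley_adj_irr S : irreflexive (cayley_adj S).
Proof. by move=> g; rewrite /cayley_adj eqxx. Qed.

Lemma cayley_adjM S k g h : cayley_adj S (k * g) (k * h) = cayley_adj S g h.
Proof.
have E x y : (k * x)^-1 * (k * y) = x^-1 * y by rewrite invgM -mulgA mulKg.
by rewrite /cayley_adj !E (inj_eq (mulgI k)).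
Qed.

Lemma cayley_walkM S k g h n : walk (cayley_adj S) g h n ->
  walk (cayley_adj S) (k * g) (k * h) n.
Proof.
move=> [p [pg ph <-]]; exists [seq k * x | x <- p].
rewrite last_map size_map ph; split=> //.
elim: p g pg {ph} => //= x p IH g /andP[gx xp].
by rewrite cayley_adjM gx IH.
Qed.

(** The elements that can be joined to 1 form a subgroup containing S. *)
Lemma cayley_connected S : generates S ->
  forall g h, exists n, walk (cayley_adj S) g h n.
Proof.
move=> gen g h.
pose H : {pred G} := fun x => `[< exists n, walk (cayley_adj S) 1 x n >].
have HH : group_closed H.
  split; first by apply/asboolP; exists 0%N; exact: walk_refl.
  move=> x y /asboolP[m xm] /asboolP[n yn]; apply/asboolP; exists (m + n)%N.
  have /(cayley_walkM (x / y)) : walk (cayley_adj S) y 1 n.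
    by apply: walk_sym yn; exact: cayley_adj_sym.
  by rewrite mulgVK mulg1; exact: walk_cat.
have SH : {subset S <= H}.
  move=> s sS; apply/asboolP; have [->|s1] := eqVneq s 1.
    by exists 0%N; exact: walk_refl.
  exists 1%N; apply: walk1.
  by rewrite /cayley_adj eq_sym s1 invg1 mul1g sS.
have /asboolP[n] := gen H HH SH (g^-1 * h).
by move/(cayley_walkM g); rewrite mulg1 mulVKg; exists n.
Qed.

Lemma word_dist_metric S : generates S -> graph_metric (word_dist S).
Proof.
move=> /cayley_connected; apply: graph_dist_metric.
  exact: cayley_adj_sym.
exact: cayley_adj_irr.
Qed.

Lemma word_dist1 S g h : generates S -> word_dist S g h = 1%N ->
  (g^-1 * h \in S) || (h^-1 * g \in S).
Proof.
move=> gen; have c := cayley_connected gen.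
by case/(graph_dist1 (@cayley_adj_sym S) (@cayley_adj_irr S) c)/andP.
Qed.

Lemma word_distM S k g h : generates S ->
  word_dist S (k * g) (k * h) = word_dist S g h.
Proof.
move=> gen; have c := cayley_connected gen.
have le x y z : (word_dist S (x * y) (x * z) <= word_dist S y z)%N.
  have [n yz] := c y z.
  by apply/graph_dist_le/cayley_walkM; exact: graph_dist_walk yz.
by apply/eqP; rewrite eqn_leq le /=; have := le k^-1 (k * g) (k * h); rewrite !mulKg.
Qed.

End CayleyGraph.

Section Action.
Variables (G : groupType) (V : choiceType) (X : simplicial_complex V).
Variable A : simplicial_action G X.
Local Notation "g • v" := (act A g v) (at level 35).
Local Open Scope group_scope.

Lemma actK g v : g^-1 • (g • v) = v.
Proof. by rewrite -actM mulVg act1. Qed.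

Lemma translate1 g v : translate A g [fset v]%fset = [fset g • v]%fset.
Proof. by rewrite /translate imfset_fset1. Qed.

Lemma act_adj g v w : adj X v w -> adj X (g • v) (g • w).
Proof.
move=> /andP[vw /asboolP vwX]; rewrite /adj (can_eq (actK g)) vw.
apply/asboolP; have := act_simplex A g [fset v; w]%fset.
by rewrite imfset_fset2 => -[_]; exact.
Qed.

Hypothesis X_conn : connected_complex X.
Let d := vdist X.
Let gm : graph_metric d := vdist_metric X_conn.

Lemma act_dist g v w : d (g • v) (g • w) = d v w.
Proof.
have le h x y : (d (h • x) (h • y) <= d x y)%N.
  have [_ /(_ x y)[n xy]] := X_conn; rewrite /d /vdist.
  have [p [px py <-]] := graph_dist_walk xy.
  apply: graph_dist_le; exists [seq h • z | z <- p].
  rewrite last_map size_map py; split=> //.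
  elim: p x px {py xy} => //= z p IH x /andP[xz zp].
  by rewrite act_adj // IH.
by apply/eqP; rewrite eqn_leq le /=; have := le g^-1 (g • v) (g • w); rewrite !actK.
Qed.

Hypothesis pd : properly_discontinuous A.
Hypothesis cc : cocompact A.

Lemma cocompact_near v0 : exists R, forall v, exists g, (d v (g • v0) <= R)%N.
Proof.
have [K [Kfin _ _] Kcov] := cc.
have vfin : finite_set (\bigcup_(s in K) [set` s]).
  by apply: bigcup_finite => // s _; exact: finite_fset.
have [R RP] := finite_set_bounded (d^~ v0) vfin; exists R => v.
have : simplices X [fset v]%fset by exact: simplex_vertex.
rewrite -Kcov => -[g _ [s Ks] sE].
have : v \in translate A g s by rewrite sE inE.
case/imfsetP => u /= us ->; exists g; rewrite act_dist.
by apply: RP; exists s.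
Qed.

(** Every edge at v is a translate g t of a simplex t of the finite subcomplex
    K, and then g sends a vertex of K to v. Adding the vertex v to K turns
    proper discontinuity into the finiteness of the set of such g. *)
Lemma finite_neighbours v : finite_set [set w | adj X v w].
Proof.
have [K [Kfin KX Kface] Kcov] := cc.
pose K' := K `|` [set [fset v]%fset].
have K'fin : finite_subcomplex X K'.
  split; first by rewrite finite_setU; split.
    by move=> s [/KX//|->]; exact: simplex_vertex.
  move=> s t [Ks ts t0|-> ]; first by left; exact: Kface ts t0.
  by rewrite fsubset1 => /orP[/eqP->|/eqP-> //]; right.
have F := pd K'fin.
set F0 := (X in finite_set X) in F.
apply: (@sub_finite_set _ _ (\bigcup_(g in F0) \bigcup_(s in K)
   [set` translate A g s])); last first.
  by apply: bigcup_finite => // g _; apply: bigcup_finite => // s _; exact: finite_fset.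
move=> w /andP[vw /asboolP vwX].
have : simplices X [fset v; w]%fset by [].
rewrite -Kcov => -[g _ [s Ks] sE].
have vs : v \in translate A g s by rewrite sE !inE eqxx.
exists g; last by exists s => //=; rewrite sE !inE eqxx orbT.
case/imfsetP: vs => u /= us uE.
exists [fset v]%fset; split; last by right.
exists [fset u]%fset; last by rewrite translate1 -uE.
left; apply: Kface Ks _ _; first by rewrite fsub1set.
by move/fsetP/(_ u); rewrite !inE eqxx.
Qed.

Lemma finite_ball v n : finite_set [set w | (d v w <= n)%N].
Proof.
elim: n => [|n IH].
  apply: (@sub_finite_set _ _ [set v]) => // w /=.
  by rewrite leqn0 => /eqP /(gm_eq0 gm).
apply: (@sub_finite_set _ _ ([set v] `|`
   \bigcup_(w in [set w | (d v w <= n)%N]) [set x | adj X w x])).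
  move=> w /= vw; case E : (d w v) => [|k].
    by left; rewrite /= (gm_eq0 gm E).
  have [z wz zv] := gm_step gm E; right; exists z => /=.
    by rewrite (gm_sym gm) zv; rewrite (gm_sym gm) E in vw.
  by rewrite adj_sym; apply/(vdist1 X_conn).
rewrite finite_setU; split=> //; apply: bigcup_finite => // w _.
exact: finite_neighbours.
Qed.

Lemma finite_returns v0 n : finite_set [set g | (d v0 (g • v0) <= n)%N].
Proof.
pose K := [set [fset u]%fset | u in [set u | (d v0 u <= n)%N]].
have Kfin : finite_subcomplex X K.
  split; first by apply: finite_image; exact: finite_ball.
    by move=> s [u _ <-]; exact: simplex_vertex.
  move=> s t [u uB <-]; rewrite fsubset1 => /orP[/eqP->|/eqP->//] _.
  by exists u.
apply: sub_finite_set (pd Kfin) => g /= gn.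
exists [fset g • v0]%fset; split; last by exists (g • v0).
exists [fset v0]%fset; last by rewrite translate1.
by exists v0 => //=; rewrite (gm_refl gm).
Qed.

End Action.

(** * Comparison of the group with the complex *)

Section MilnorSchwarz.
Variables (G : groupType) (V : choiceType) (X : simplicial_complex V).
Variable A : simplicial_action G X.
Hypothesis X_conn : connected_complex X.
Let d := vdist X.
Let gm : graph_metric d := vdist_metric X_conn.
Let dC := gm_sym gm.
Let dT := gm_tri gm.
Let d0 := gm_refl gm.
Local Open Scope group_scope.
Local Open Scope nat_scope.
Variables (v0 : V) (R : nat).
Let orb g := act A g v0.
Hypothesis near : forall v, exists g, d v (orb g) <= R.

Lemma dist_orbit g h : d (orb g) (orb h) = d v0 (orb (g^-1 * h)%g).
Proof. by rewrite /d -(act_dist A X_conn g^-1) /orb actK actM. Qed.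

(** Follow a geodesic from x to y and choose an orbit point within R of each of
    its vertices: consecutive choices are at distance at most 2R + 1. *)
Lemma orbit_chain_ind (P : G -> nat -> Prop) (g : G) :
  (forall k h n, P k n -> d (orb k) (orb h) <= (2 * R).+1 -> P h n.+1) ->
  P g 0 -> forall x y h, d x (orb g) <= R -> d y (orb h) <= R ->
  P h (d x y).+1.
Proof.
move=> step Pg x y h xg.
rewrite (dC x y); move en : (d y x) => n.
elim: n y h en => [|n IH] y h en yh.
  apply: step Pg _; rewrite (gm_eq0 gm en) in yh.
  by have := dT (orb g) x (orb h); rewrite (dC (orb g) x); lia.
have [z yz zx] := gm_step gm en.
have [k zk] := near z.
apply: step (IH z k zx zk) _.
have := dT (orb k) z (orb h); have := dT z y (orb h).
by rewrite (dC (orb k) z) (dC z y); lia.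
Qed.

Lemma word_dist_le_dist S : generates S ->
  finite_set [set g | d v0 (orb g) <= (2 * R).+1] ->
  exists M, forall x y g h, d x (orb g) <= R -> d y (orb h) <= R ->
    word_dist S g h <= M * (d x y).+1.
Proof.
move=> gen fin; have wgm := word_dist_metric gen.
have [M MP] := finite_set_bounded (word_dist S 1%g) fin.
exists M => x y g h.
apply: (@orbit_chain_ind (fun k n => word_dist S g k <= M * n) g).
  move=> k {}h n gk kh; have := gm_tri wgm g k h.
  suff : word_dist S k h <= M by rewrite mulnS; lia.
  rewrite -(word_distM k^-1 k h gen) mulVg.
  by apply: MP; rewrite /= -dist_orbit.
by rewrite (gm_refl wgm).
Qed.

Lemma dist_le_word_dist S : generates S ->
  exists C, forall g h, d (orb g) (orb h) <= C * word_dist S g h.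
Proof.
move=> gen; have wgm := word_dist_metric gen.
pose C := \max_(s <- S) d v0 (orb s); exists C => g h.
have CP s : s \in S -> d v0 (orb s) <= C.
  by move=> sS; exact: (leq_bigmax_seq s).
move en : (word_dist S g h) => n; elim: n g en => [|n IH] g en.
  by rewrite (gm_eq0 wgm en) d0.
have [k gk kh] := gm_step wgm en.
have : d (orb g) (orb k) <= C.
  case/orP: (word_dist1 gen gk) => /CP; rewrite -dist_orbit //.
  by rewrite dC.
by have := dT (orb g) (orb k) (orb h); have := IH k kh; rewrite mulnS; lia.
Qed.

Lemma generates_returns S :
  (forall g, d v0 (orb g) <= (2 * R).+1 -> g \in S) -> generates S.
Proof.
move=> SP H [H1 HV] SH h.
have [g gP] := near v0.
have HM := group_closedM (conj H1 HV).
have [k kP] := near (orb h).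
have hh : d (orb h) (orb h) <= R by rewrite d0.
have one_near : d v0 (orb 1%g) <= R by rewrite /orb act1 d0.
apply: (@orbit_chain_ind (fun k _ => k \in H) 1%g _ H1 v0 _ h one_near hh).
move=> k' h' _ k'H kh; rewrite -(mulVKg k' h'); apply: HM => //.
by apply/SH/SP; rewrite -dist_orbit.
Qed.

(** The generators are the elements moving v0 by at most 2R + 1, and L g h
    consists of the elements whose orbit point is near the interval between
    the orbit points of g and h. *)
Lemma slim_geod_hyperbolic K :
  finite_set [set g | d v0 (orb g) <= (2 * R).+1] ->
  (forall x y z p, geod_interval d x y p ->
     exists2 q, geod_interval d x z q \/ geod_interval d z y q & d p q <= K) ->
  hyperbolic_group G.
Proof.
move=> fin slim; have [S SE] := (finite_seqP _).1 fin.
have gen : generates S.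
  apply: generates_returns => g; have : [set` S] g = (d v0 (orb g) <= (2 * R).+1) :> Prop.
    by rewrite -SE.
  by move=> /= ->.
exists S => //; have wgm := word_dist_metric gen.
apply/(gromov_hyperbolicP wgm).
have [M MP] := word_dist_le_dist gen fin.
have [C CP] := dist_le_word_dist gen.
pose L g h : set G := [set k | exists2 p, geod_interval d (orb g) (orb h) p & d p (orb k) <= R].
have LI g h p : geod_interval d (orb g) (orb h) p -> exists k, L g h k /\ d p (orb k) <= R.
  by move=> pI; have [k pk] := near p; exists k; split=> //; exists p.
apply: (@slim_family_four_point _ _ wgm L (M * (K + C + 1).+1)).
- move=> g h.
  have [p [p0 pn pg]] := ex_geodesic gm (orb g) (orb h).
  set n := d (orb g) (orb h) in pn pg *.
  have pI i : i <= n -> geod_interval d (orb g) (orb h) (p i).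
    by move=> i_n; have := pg 0 i; have := pg i n; rewrite p0 pn /geod_interval /= -/n; lia.
  have /choice [k kP] : forall i, exists k, i <= n ->
      L g h k /\ d (p i) (orb k) <= R.
    move=> i; have [i_n|] := leqP i n; last by exists 1%g.
    by have [k ?] := LI g h (p i) (pI i i_n); exists k.
  (* The elements chosen along the geodesic, between g and h themselves. *)
  pose s i := if i is i'.+1 then if i' <= n then k i' else h else g.
  exists n.+2, s; split=> //.
  + by rewrite /s ltnn.
  + move=> [|i] _ /=.
      by exists (orb g); rewrite ?d0 //; exact: geod_l.
    case: leqP => i_n; first by have [] := kP i i_n.
    by exists (orb h); rewrite ?d0 //; exact: geod_r.
  + move=> i; rewrite ltnS => i_n.
    pose x j := if j is j'.+1 then if j' <= n then p j' else orb h else orb g.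
    have xs j : d (x j) (orb (s j)) <= R.
      case: j => [|j] /=; first by rewrite d0.
      by case: (leqP j n) => j_n; [have [] := kP j j_n|rewrite d0].
    have xx : d (x i) (x i.+1) <= 1.
      case: i i_n => [|i] i_n /=; first by rewrite p0 d0.
      case: (leqP i n) => j1; case: leqP => j2; rewrite ?d0 ?pg //; try lia.
      have -> : i = n by lia.
      by rewrite pn d0.
    apply: leq_trans (MP _ _ _ _ (xs i) (xs i.+1)) _.
    by rewrite leq_mul2l; apply/orP; right; lia.
- move=> g h k gh [p pI pk].
  have gp : d (orb g) p <= C.
    have := CP g h; have : C * word_dist S g h <= C * 1 by rewrite leq_mul2l gh orbT.
    by rewrite /geod_interval /= in pI; lia.
  have gg : d (orb g) (orb g) <= R by rewrite d0.
  apply: leq_trans (MP _ _ _ _ gg pk) _.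
  by rewrite leq_mul2l; apply/orP; right; lia.
- move=> g h z k [p pI pk].
  have [q qI pq] := slim _ _ (orb z) _ pI.
  have [k' qk'] := near q.
  exists k'; first by case: qI => qI; [left|right]; exists q.
  apply: leq_trans (MP _ _ _ _ pk qk') _.
  by rewrite leq_mul2l; apply/orP; right; lia.
Qed.

(** Choosing near each f a b an orbit point makes f a quasi-isometric grid in the
    Cayley graph. *)
Lemma hyperbolic_no_grid (f : nat -> nat -> V) :
  finite_set [set g | d v0 (orb g) <= (2 * R).+1] ->
  hyperbolic_group G ->
  (forall a b, d (f a b) (f a.+1 b) <= 1) ->
  (forall a b, d (f a b) (f a b.+1) <= 1) ->
  (forall a b a' b', a <= a' + d (f a b) (f a' b')) ->
  (forall a b a' b', b <= b' + d (f a b) (f a' b')) -> False.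
Proof.
move=> fin [S gen hyp] fa fb la lb.
have wgm := word_dist_metric gen.
have [D fp] := (gromov_hyperbolicP wgm).1 hyp.
have [M MP] := word_dist_le_dist gen fin.
have [C CP] := dist_le_word_dist gen.
have /choice [phi phiP] : forall ab, exists g, d (f ab.1 ab.2) (orb g) <= R.
  by move=> ab; exact: near.
pose B := 2 * M + C + 2 * R.
have up ab ab' : d (f ab.1 ab.2) (f ab'.1 ab'.2) <= 1 ->
    word_dist S (phi ab) (phi ab') <= B.
  move=> le1; apply: leq_trans (MP _ _ _ _ (phiP ab) (phiP ab')) _.
  have : M * (d (f ab.1 ab.2) (f ab'.1 ab'.2)).+1 <= M * 2.
    by rewrite leq_mul2l ltnS le1 orbT.
  by rewrite /B; lia.
have low ab ab' : d (f ab.1 ab.2) (f ab'.1 ab'.2) <=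
    B * word_dist S (phi ab) (phi ab') + B.
  have := phiP ab; have := phiP ab'; have := CP (phi ab) (phi ab').
  have := dT (f ab.1 ab.2) (orb (phi ab)) (f ab'.1 ab'.2).
  have := dT (orb (phi ab)) (orb (phi ab')) (f ab'.1 ab'.2).
  have : C * word_dist S (phi ab) (phi ab') <= B * word_dist S (phi ab) (phi ab').
    by rewrite leq_mul2r /B; apply/orP; right; lia.
  have : 2 * R <= B by rewrite leq_addl.
  by rewrite (dC (orb (phi ab'))); lia.
apply: (@four_point_no_grid _ _ wgm D B (fun a b => phi (a, b)) fp).
- by move=> a b; apply: up; exact: fa.
- by move=> a b; apply: up; exact: fb.
- by move=> a b a' b'; have /= := low (a, b) (a', b'); have := la a b a' b'; lia.
- by move=> a b a' b'; have /= := low (a, b) (a', b'); have := lb a b a' b'; lia.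
Qed.

End MilnorSchwarz.

(** * The systolic plane and limits of flat triangles *)

(** Steps of the triangular lattice change (a, b) by one of (1, 0), (0, 1),
    (1, -1) or their opposites; this is the norm whose unit ball is the hexagon
    spanned by these six vectors. *)
Definition hex_dist (p q : int * int) : nat :=
  maxn (maxn `|(p.1 - q.1)%R| `|(p.2 - q.2)%R|)
       `|(p.1 + p.2 - (q.1 + q.2))%R|.

Lemma hex_dist_tri p q r : hex_dist p r <= hex_dist p q + hex_dist q r.
Proof.
rewrite /hex_dist !geq_max; apply/andP; split; [apply/andP; split|]; lia.
Qed.

Lemma up_triangle_hex p q r : q \in up_triangle p -> r \in up_triangle p ->
  hex_dist q r <= 1.
Proof.
rewrite !inE => /orP[/orP[]|] /eqP -> /orP[/orP[]|] /eqP ->;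
  by rewrite /hex_dist /=; lia.
Qed.

Lemma down_triangle_hex p q r : q \in down_triangle p ->
  r \in down_triangle p -> hex_dist q r <= 1.
Proof.
rewrite !inE => /orP[/orP[]|] /eqP -> /orP[/orP[]|] /eqP ->;
  by rewrite /hex_dist /=; lia.
Qed.

Lemma plane_simplex_hex s q r : plane_simplices s -> q \in s -> r \in s ->
  hex_dist q r <= 1.
Proof.
move=> [_ [p [/fsubsetP sub|/fsubsetP sub]]] /sub qs /sub rs.
  exact: up_triangle_hex qs rs.
exact: down_triangle_hex qs rs.
Qed.

Lemma plane_adj_of_sub (p q : int * int) (t : {fset int * int}) : p != q ->
  p \in t -> q \in t ->
  (exists r, t = up_triangle r \/ t = down_triangle r) ->
  adj systolic_plane p q.
Proof.
move=> pq pt qt [r tE]; rewrite /adj pq; apply/asboolP; split.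
  by move/fsetP/(_ p); rewrite !inE eqxx.
exists r; case: tE pt qt => -> pt qt; [left|right];
  by rewrite fsubUset !fsub1set pt.
Qed.

Lemma plane_adj_r (a b : int) : adj systolic_plane (a, b) (a + 1, b)%R.
Proof.
apply: (@plane_adj_of_sub _ _ (up_triangle (a, b))); last by exists (a, b); left.
- by rewrite xpair_eqE; lia.
- by rewrite !inE eqxx.
- by rewrite !inE eqxx orbT.
Qed.

Lemma plane_adj_u (a b : int) : adj systolic_plane (a, b) (a, b + 1)%R.
Proof.
apply: (@plane_adj_of_sub _ _ (up_triangle (a, b))); last by exists (a, b); left.
- by rewrite xpair_eqE; lia.
- by rewrite !inE eqxx.
- by rewrite !inE eqxx orbT.
Qed.

Lemma plane_adj_d (a b : int) : adj systolic_plane (a, b + 1)%R (a + 1, b)%R.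
Proof.
apply: (@plane_adj_of_sub _ _ (up_triangle (a, b))); last by exists (a, b); left.
- by rewrite xpair_eqE; lia.
- by rewrite !inE eqxx orbT.
- by rewrite !inE eqxx orbT.
Qed.

Lemma hex_step p q n : hex_dist p q = n.+1 ->
  exists2 r, adj systolic_plane p r & hex_dist r q = n.
Proof.
case: p q => [a b] [c e]; rewrite /hex_dist /= => en.
have adjC := adj_sym systolic_plane.
have [[h1 h2]|[[h1 h2]|[[h1 h2]|[[h1 h2]|[[h1 h2]|[h1 h2]]]]]] :
  (a < c /\ b <= e \/ a < c /\ e < b \/ c < a /\ e <= b \/ c < a /\ b < e \/
   a = c /\ b < e \/ a = c /\ e <= b)%R by lia.
- by exists (a + 1, b)%R; [exact: plane_adj_r|rewrite /=; lia].
- exists (a + 1, b - 1)%R; last by rewrite /=; lia.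
  by have := plane_adj_d a (b - 1); rewrite GRing.subrK.
- exists (a - 1, b)%R; last by rewrite /=; lia.
  by rewrite adjC; have := plane_adj_r (a - 1) b; rewrite GRing.subrK.
- exists (a - 1, b + 1)%R; last by rewrite /=; lia.
  by rewrite adjC; have := plane_adj_d (a - 1) b; rewrite GRing.subrK.
- by exists (a, b + 1)%R; [exact: plane_adj_u|rewrite /=; lia].
exists (a, b - 1)%R; last by rewrite /=; lia.
by rewrite adjC; have := plane_adj_u a (b - 1); rewrite GRing.subrK.
Qed.

Lemma plane_vdist p q : vdist systolic_plane p q = hex_dist p q.
Proof.
have w : walk (adj systolic_plane) p q (hex_dist p q).
  move en : (hex_dist p q) => n; elim: n p en => [|n IH] p en.
    have -> : p = q.
      case: p q en => [a b] [c e]; rewrite /hex_dist /= => en.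
      by congr pair; lia.
    exact: walk_refl.
  have [r pr rq] := hex_step en.
  by rewrite -add1n; apply: walk_cat (walk1 pr) (IH r rq).
apply/eqP; rewrite eqn_leq (graph_dist_le w) /=.
rewrite /vdist; have [s [ps <- <-]] := graph_dist_walk w.
elim: s p ps {w} => [|r s IH] p /=.
  by move=> _; rewrite /hex_dist !GRing.subrr.
move=> /andP[/andP[_ /asboolP prX] rs]; apply: leq_trans (hex_dist_tri p r _) _.
rewrite -add1n leq_add ?IH //.
by apply: plane_simplex_hex prX _ _; rewrite !inE eqxx ?orbT.
Qed.

Lemma ultrafilter_finite_value (T : choiceType) (U : set_system nat)
    (phi : nat -> T) (B : set T) : UltraFilter U -> finite_set B ->
  U [set r | B (phi r)] -> exists x, U [set r | phi r = x].
Proof.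
move=> UU /finite_seqP[s ->]; elim: s => [|x s IH] /= Us.
  by case: (filter_ex Us).
have [Ux|Unx] := in_ultra_setVsetC [set r | phi r = x] UU; first by exists x.
apply: IH; apply: filterS (filterI Us Unx) => r /= [].
by rewrite inE => /predU1P[].
Qed.

(** Since X is flag, triangles go to simplices as soon as their vertices go to
    adjacent vertices. *)
Lemma hex_isometric_embedding (V : choiceType) (X : simplicial_complex V)
    (f : int * int -> V) : connected_complex X -> flag X ->
  (forall p q, vdist X (f p) (f q) = hex_dist p q) ->
  isometric_embedding systolic_plane X f.
Proof.
move=> X_conn Xflag fd; split=> [s sP|v w]; last by rewrite fd plane_vdist.
apply: Xflag.
  have [s0|[p ps]] := fset_0Vmem s; first by case: sP.
  by move/fsetP/(_ (f p)); rewrite !inE in_imfset.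
move=> v w /imfsetP[p /= ps ->] /imfsetP[q /= qs ->] neq.
apply/(vdist1 X_conn); rewrite fd.
have := plane_simplex_hex sP ps qs; case E : (hex_dist p q) => [|[|n]] // _.
move: neq; have := fd p q; rewrite E => /(gm_eq0 (vdist_metric X_conn)) ->.
by rewrite eqxx.
Qed.

Lemma deltoid_dist_hex (r : nat) (p q : int * int) j l j' l' :
  (l%:Z = r%:Z + p.1)%R -> (j%:Z = l%:Z + r%:Z + p.2)%R ->
  (l'%:Z = r%:Z + q.1)%R -> (j'%:Z = l'%:Z + r%:Z + q.2)%R ->
  l <= j -> l' <= j' -> deltoid_dist j l j' l' = hex_dist p q.
Proof.
move=> lE jE l'E j'E lj lj'; rewrite /hex_dist.
have -> : (p.1 - q.1)%R = (l%:Z - l'%:Z)%R by lia.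
have -> : (p.2 - q.2)%R = ((j - l)%N%:Z - (j' - l')%N%:Z)%R by lia.
have -> : (p.1 + p.2 - (q.1 + q.2))%R = (j%:Z - j'%:Z)%R by lia.
rewrite /deltoid_dist maxnAC; move: (j - l) (j' - l') => m m'.
by clear; congr (maxn (maxn _ _) _); lia.
Qed.

Section Limit.
Variables (G : groupType) (V : choiceType) (X : simplicial_complex V).
Variable A : simplicial_action G X.
Hypothesis X_conn : connected_complex X.
Hypothesis ws : weakly_systolic X.
Hypothesis geom : geometric_action A.
Let d := vdist X.
Let gm : graph_metric d := vdist_metric X_conn.
Let O : int * int := (0, 0)%R.

(** For every p the values f r p, for r large, lie in a ball around v0, which is
    finite; hence one of them is taken for almost all r with respect to a
    nonprincipal ultrafilter, and this is the value of the limit at p. Any two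
    values of the limit are those of one f r with r large. *)
Lemma hexagons_plane v0 R :
  (forall r, exists f : int * int -> V, d v0 (f O) <= R /\
     forall p q, hex_dist O p <= r -> hex_dist O q <= r ->
       d (f p) (f q) = hex_dist p q) ->
  exists f, isometric_embedding systolic_plane X f.
Proof.
case: geom => pd cc /choice[f fP].
have [U [UU Uoo]] := ultraFilterLemma (F := \oo) _.
have ev r : U [set n | r <= n] by apply: Uoo; exists r.
have /choice[F FP] p : exists x, U [set n | f n p = x].
  have B := finite_ball X_conn pd cc v0 (R + hex_dist O p).
  apply: (ultrafilter_finite_value UU B).
  apply: filterS (ev (hex_dist O p)) => n /= pn; have [f0 fd] := fP n.
  have := gm_tri gm v0 (f n O) (f n p); rewrite fd //.
    by rewrite /= -/d; lia.
exists F; apply: hex_isometric_embedding => //; first by case: ws.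
move=> p q; have [n] := filter_ex (filterI (filterI (FP p) (FP q))
  (ev (maxn (hex_dist O p) (hex_dist O q)))).
move=> [[/= <- <-]]; rewrite geq_max => /andP[pn qn].
by have [_ fd] := fP n; exact: fd.
Qed.

(** A flat triangle of side at least 3r contains the hexagon of radius r centred
    at position r of row 2r; cocompactness moves this centre near v0. *)
Lemma deltoids_plane :
  (forall n, exists k f, n <= k /\ deltoid d k f) ->
  exists f, isometric_embedding systolic_plane X f.
Proof.
move=> big; case: (X_conn) => -[v0] _.
have [pd cc] := geom.
have [R near] := cocompact_near X_conn cc v0.
apply: (@hexagons_plane v0 R) => r.
have [k [f [rk fd]]] := big (3 * r).
have [g gP] := near (f (2 * r) r).
pose row (p : int * int) := `|((2 * r)%N%:Z + p.1 + p.2)%R|.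
pose pos (p : int * int) := `|(r%:Z + p.1)%R|.
exists (fun p => act A g^-1%g (f (row p) (pos p))); split.
  have -> : row O = 2 * r by rewrite /row /O /=; lia.
  have -> : pos O = r by rewrite /pos /O /=; lia.
  by rewrite (gm_sym gm) -{1}(actK A g v0) /d (act_dist A X_conn).
move=> p q pr qr; rewrite /d (act_dist A X_conn) -/d.
rewrite /hex_dist /= !geq_max in pr qr.
have [/andP[/andP[p1 p2] p3] /andP[/andP[q1 q2] q3]] := (pr, qr).
have posE x : `|x.1| <= r -> ((pos x)%:Z = r%:Z + x.1)%R.
  by rewrite /pos; lia.
have rowE x : `|x.1| <= r -> `|x.2| <= r ->
    ((row x)%:Z = (pos x)%:Z + r%:Z + x.2)%R.
  by move=> x1 x2; rewrite posE // /row; lia.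
have pqE : [/\ `|p.1| <= r, `|p.2| <= r, `|q.1| <= r & `|q.2| <= r].
  by split; lia.
case: pqE => p1' p2' q1' q2'.
have pp := posE p p1'; have rp := rowE p p1' p2'.
have pq := posE q q1'; have rq := rowE q q1' q2'.
rewrite fd; [apply: (deltoid_dist_hex pp rp pq rq); lia|lia..].
Qed.

End Limit.

Theorem theorem7p1 (G : groupType) (V : choiceType) (X : simplicial_complex V)
    (A : simplicial_action G X) :
  connected_complex X -> weakly_systolic X -> geometric_action A ->
  (hyperbolic_group G <->
   ~ exists f : int * int -> V, isometric_embedding systolic_plane X f).
Proof.
move=> X_conn ws geom; have [pd cc] := geom; have [[v0] _] := X_conn.
have [R near] := cocompact_near X_conn cc v0.
have fin := finite_returns X_conn pd cc v0 (2 * R).+1.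
have wsd := weakly_systolic_vdist X_conn ws.
split=> [hyp [f [_ fd]]|no_plane].
  have fE p q : vdist X (f p) (f q) = hex_dist p q by rewrite fd plane_vdist.
  apply: (hyperbolic_no_grid X_conn near
            (f := fun a b => f (a%:Z, b%:Z)%R) fin hyp) => a b.
  - by rewrite fE /hex_dist /=; lia.
  - by rewrite fE /hex_dist /=; lia.
  - by move=> a' b'; rewrite fE /hex_dist /=; lia.
  - by move=> a' b'; rewrite fE /hex_dist /=; lia.
have [mu small] : exists mu, forall u v w,
    metric_triangle (vdist X) u v w -> vdist X u v <= mu.
  apply: contrapT => /forallNP unbounded; apply: no_plane.
  apply: (deltoids_plane X_conn ws geom) => n.
  have /existsNP[u /existsNP[v /existsNP[w /not_implyP[mt /negP]]]] :=
    unbounded n.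
  rewrite -ltnNge => n_lt; exists (vdist X u v).
  have [p [p0 pn pg]] := ex_geodesic (ws_gm wsd) v w.
  have [_ vw] := metric_triangle_equilateral wsd mt.
  rewrite vw in pn pg.
  have [f [_ _ fd]] := metric_triangle_deltoid wsd mt erefl p0 pn pg.
  by exists f; split=> //; exact: ltnW.
apply: (slim_geod_hyperbolic X_conn near fin) => x y z p pI.
exact: (geod_slim wsd small z pI).
Qed.
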